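(* Let $p$ be a prime and let $m\geq 3$ be an integer. There is an uncountable family of pairwise non-commensurable metabelian uniform pro-$p$ groups of dimension $m$. Consequently, there is an uncountable family of pairwise non-commensurable finitely presented pro-$p$ groups whose minimal number of (topological) generators is $m$ (and whose minimal number of relations is $\binom{m}{2}$).
   Context: For a pro-$p$ group $G$, $[G,G]$ and $G^n$ denote the closures of the commutator subgroup and of the subgroup generated by all $n$th powers. A pro-$p$ group $G$ is powerful if $p\geq 3$ and $[G,G]\leq G^p$, or $p=2$ and $[G,G]\leq G^4$. A powerful pro-$p$ group is uniform if it is (topologically) finitely generated and torsion-free. The dimension of a uniform pro-$p$ group $G$ is its dimension as a $p$-adic analytic manifold; it equals $d(G)$, the minimal number of topological generators of $G$. Two pro-$p$ groups are commensurable if they have open subgroups that are isomorphic to each other (as topological groups). Finite presentability and the number of relations are understood in the category of pro-$p$ groups: $G$ is finitely presented if $G\cong F/R$ with $F$ a free pro-$p$ group of finite rank and $R$ a closed normal subgroup which is the closed normal closure of finitely many elements (relations). *)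

(* Defs.v *)
From HB Require Import structures.
From mathcomp Require Import all_boot all_order all_algebra finmap.
From mathcomp Require Import boolp classical_sets functions cardinality.
From mathcomp Require Import topology.

Set Implicit Arguments.
Unset Strict Implicit.
Unset Printing Implicit Defensive.

Import GRing.Theory.

Local Open Scope classical_set_scope.
Local Open Scope card_scope.

HB.mixin Record Group_isTopologicalGroup G of Group G & Topological G := {
  mulg_continuous : continuous (fun xy : G * G => (xy.1 * xy.2)%g);
  invg_continuous : continuous (fun x : G => x^-1%g)
}.

#[short(type="topGroupType")]
HB.structure Definition TopologicalGroup :=
  {G of Group G & Topological G & Group_isTopologicalGroup G}.

Section Subgroups.
Variable G : topGroupType.
Implicit Types (A H : set G) (n : nat).

Definition subgroup H : Prop :=
  H 1%g /\ forall x y, H x -> H y -> H (x * y^-1)%g.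

Definition normal_subgroup H : Prop :=
  subgroup H /\ forall x g, H x -> H (x ^ g)%g.

Definition left_cosets H : set (set G) :=
  [set [set (g * h)%g | h in H] | g in [set: G]].

Definition closed_gen A : set G := closure (smallest subgroup A).

Definition closed_normal_closure A : set G :=
  closure (smallest normal_subgroup A).

Definition closed_derived : set G :=
  closed_gen [set [~ xy.1, xy.2]%g | xy in [set: G * G]].

Definition closed_power n : set G := closed_gen [set (x ^+ n)%g | x in [set: G]].

Definition metabelian : Prop :=
  forall x y, closed_derived x -> closed_derived y -> commute x y.

Definition torsion_free : Prop :=
  forall (x : G) n, (0 < n)%N -> (x ^+ n)%g = 1%g -> x = 1%g.

(* The generators need not be distinct: "generated by at most n elements". *)
Definition gen_by n : Prop :=
  exists s : 'I_n -> G, closed_gen (range s) = [set: G].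

Definition finitely_generated : Prop := exists n, gen_by n.

Definition min_gens n : Prop := gen_by n /\ forall k, gen_by k -> (n <= k)%N.

End Subgroups.

Arguments metabelian : clear implicits.
Arguments torsion_free : clear implicits.
Arguments gen_by : clear implicits.
Arguments finitely_generated : clear implicits.
Arguments min_gens : clear implicits.
Arguments closed_derived : clear implicits.
Arguments closed_power : clear implicits.

Definition continuous_hom (G H : topGroupType) (f : G -> H) : Prop :=
  {morph f : x y / (x * y)%g >-> (x * y)%g} /\ continuous f.

(* [H] and [K] carry the subspace topologies; [f] and [g] are total functions of
   which only the restrictions to [H] and [K] matter. *)
Definition subgroup_top_iso (G L : topGroupType) (H : set G) (K : set L) : Prop :=
  exists (f : G -> L) (g : L -> G),
  [/\ (forall x, H x -> K (f x) /\ g (f x) = x),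
      (forall y, K y -> H (g y) /\ f (g y) = y),
      (forall x y, H x -> H y -> f (x * y)%g = (f x * f y)%g),
      {within H, continuous f} & {within K, continuous g}].

Definition commensurable (G L : topGroupType) : Prop :=
  exists (H : set G) (K : set L),
  [/\ subgroup H, open H, subgroup K, open K & subgroup_top_iso H K].

(* The third condition says that the open subgroups form a base of
   neighbourhoods of 1; with the first two, that G is profinite. *)
Definition pro_p (p : nat) (G : topGroupType) : Prop :=
  [/\ compact [set: G],
      hausdorff_space G,
      (forall U : set G, nbhs 1%g U ->
         exists H : set G, [/\ subgroup H, open H & H `<=` U])
    & (forall N : set G, normal_subgroup N -> open N ->
         exists k, left_cosets N #= `I_(p ^ k))].

Definition powerful (p : nat) (G : topGroupType) : Prop :=
  pro_p p G /\
  closed_derived G `<=` closed_power G (if p == 2%N then 4 else p).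

Definition uniform_pro_p (p : nat) (G : topGroupType) : Prop :=
  [/\ powerful p G, finitely_generated G & torsion_free G].

Definition free_pro_p (p n : nat) (F : topGroupType) (e : 'I_n -> F) : Prop :=
  pro_p p F /\
  forall (P : topGroupType) (u : 'I_n -> P), pro_p p P ->
    exists! f : F -> P, continuous_hom f /\ forall i, f (e i) = u i.

(* G is isomorphic to F / R, with F free pro-p of rank n and R the closed normal
   closure of r elements: an isomorphism F / R -> G of topological groups is the
   same as a continuous open surjective homomorphism F -> G with kernel R. *)
Definition has_presentation (p : nat) (G : topGroupType) (n r : nat) : Prop :=
  exists (F : topGroupType) (e : 'I_n -> F) (rel : 'I_r -> F) (f : F -> G),
  [/\ free_pro_p p e, continuous_hom f,
      (forall U : set F, open U -> open (f @` U)),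
      range f = [set: G]
    & [set x | f x = 1%g] = closed_normal_closure (range rel)].

Definition finitely_presented (p : nat) (G : topGroupType) : Prop :=
  exists n r, has_presentation p G n r.

Definition min_rels (p : nat) (G : topGroupType) (r : nat) : Prop :=
  (exists n, has_presentation p G n r) /\
  forall n k, has_presentation p G n k -> (r <= k)%N.

Local Open Scope ring_scope.

(* The inverse limit of the rings Z / p ^ n: the n-th term of a coherent sequence
   is the canonical representative of a residue class modulo p ^ n. *)
Definition coherent (p : nat) (x : nat -> int) : Prop :=
  forall n, x n = (x n.+1 %% (p ^ n)%N)%Z.

Record padic_int (p : nat) :=
  PadicInt { pval :> nat -> int; _ : `[< coherent p pval >] }.

HB.instance Definition _ p := [isSub for @pval p].
HB.instance Definition _ p := [Choice of padic_int p by <:].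

Section PadicRing.
Variable p : nat.
Implicit Types (x y z : padic_int p) (a b : nat -> int).

Let M n : int := (p ^ n)%N.

Let reduce a n := (a n %% M n)%Z.

Let compatible a := forall n, (a n.+1 = a n %[mod M n])%Z.

Lemma modzMX (a : int) n : ((a %% M n.+1)%Z = a %[mod M n])%Z.
Proof.
apply/eqP; rewrite eqz_mod_dvd; apply: (@dvdz_trans (M n.+1)).
  by rewrite /M expnS PoszM dvdz_mull.
by rewrite -eqz_mod_dvd modz_mod.
Qed.

Lemma coherent_reduce a : compatible a -> coherent p (reduce a).
Proof. by move=> ca n; rewrite /reduce modzMX ca. Qed.

Definition mk_padic a (ca : compatible a) : padic_int p :=
  PadicInt (asboolT (coherent_reduce ca)).

Lemma pval_coherent x : coherent p x.
Proof. by case: x => x /= /asboolP. Qed.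

Lemma pval_mod x n : (x n %% M n)%Z = x n.
Proof. by rewrite {1}pval_coherent modz_mod -pval_coherent. Qed.

Lemma pval_compatible x : compatible x.
Proof. by move=> n; rewrite pval_mod (pval_coherent x n). Qed.

Lemma padicP x y : (forall n, x n = y n) -> x = y.
Proof. by move=> xy; apply/val_inj/funext. Qed.

Fact cst_compatible (c : int) : compatible (fun=> c). Proof. by []. Qed.

Fact add_compatible x y : compatible (fun n => x n + y n).
Proof. by move=> n; rewrite -modzDm !pval_compatible modzDm. Qed.

Fact opp_compatible x : compatible (fun n => - x n).
Proof. by move=> n; rewrite -modzNm pval_compatible modzNm. Qed.

Fact mul_compatible x y : compatible (fun n => x n * y n).
Proof. by move=> n; rewrite -modzMm !pval_compatible modzMm. Qed.

Definition padic_zero := mk_padic (cst_compatible 0).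
Definition padic_one := mk_padic (cst_compatible 1).
Definition padic_opp x := mk_padic (opp_compatible x).
Definition padic_add x y := mk_padic (add_compatible x y).
Definition padic_mul x y := mk_padic (mul_compatible x y).

Fact padic_addA : associative padic_add.
Proof. by move=> x y z; apply: padicP => n; rewrite /= /reduce modzDmr modzDml addrA. Qed.

Fact padic_addC : commutative padic_add.
Proof. by move=> x y; apply: padicP => n; rewrite /= /reduce addrC. Qed.

Fact padic_add0 : left_id padic_zero padic_add.
Proof. by move=> x; apply: padicP => n; rewrite /= /reduce modzDml add0r pval_mod. Qed.

Fact padic_addN : left_inverse padic_zero padic_opp padic_add.
Proof. by move=> x; apply: padicP => n; rewrite /= /reduce modzDml addNr. Qed.

HB.instance Definition _ := GRing.isZmodule.Build (padic_int p)
  padic_addA padic_addC padic_add0 padic_addN.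

Fact padic_mulA : associative padic_mul.
Proof. by move=> x y z; apply: padicP => n; rewrite /= /reduce modzMmr modzMml mulrA. Qed.

Fact padic_mulC : commutative padic_mul.
Proof. by move=> x y; apply: padicP => n; rewrite /= /reduce mulrC. Qed.

Fact padic_mul1 : left_id padic_one padic_mul.
Proof. by move=> x; apply: padicP => n; rewrite /= /reduce modzMml mul1r pval_mod. Qed.

Fact padic_mulDl : left_distributive padic_mul padic_add.
Proof.
by move=> x y z; apply: padicP => n; rewrite /= /reduce modzMml modzDm mulrDl.
Qed.

HB.instance Definition _ := GRing.Zmodule_isComPzRing.Build (padic_int p)
  padic_mulA padic_mulC padic_mul1 padic_mulDl.

Definition padic_open : set_system (padic_int p) :=
  [set U | forall x, U x -> exists n, forall y, y n = x n -> U y].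

Fact padic_openT : padic_open setT.
Proof. by move=> x _; exists 0%N. Qed.

Lemma padic_le x y m n : (m <= n)%N -> y n = x n -> y m = x m.
Proof.
elim: n => [|n IHn]; first by rewrite leqn0 => /eqP ->.
rewrite leq_eqVlt => /predU1P[-> //|/IHn {}IHn yx].
by apply: IHn; rewrite (pval_coherent y) yx -(pval_coherent x).
Qed.

Fact padic_openI : setI_closed padic_open.
Proof.
move=> U V oU oV x [/oU[m Um] /oV[n Vn]]; exists (maxn m n) => y yx.
by split; [apply/Um/(padic_le _ yx)/leq_maxl | apply/Vn/(padic_le _ yx)/leq_maxr].
Qed.

Fact padic_open_bigU (I : Type) (f : I -> set (padic_int p)) :
  (forall i, padic_open (f i)) -> padic_open (\bigcup_i f i).
Proof. by move=> of_ x [i _ /of_[n fn]]; exists n => y /fn; exists i. Qed.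

HB.instance Definition _ := isOpenTopological.Build (padic_int p)
  padic_openT padic_openI padic_open_bigU.

End PadicRing.

Definition totally {I : choiceType} : set_system {fset I} :=
  filter_from setT (fun A => [set B | A `<=` B]%fset).

(* The power series with coefficients [c] converges (unconditionally) at [z], with
   sum [v]. *)
Definition power_series_at (p r : nat) (c : {ffun 'I_r -> nat} -> padic_int p)
    (z : 'rV[padic_int p]_r) (v : padic_int p) : Prop :=
  (fun S : {fset {ffun 'I_r -> nat}} =>
     \sum_(a <- S) c a * \prod_(j < r) z 0 j ^+ a j) @ totally --> v.

(* With phi a chart of X on U at x0 and psi a chart of Y on V at f x0, the function
   h := psi \o f \o phi^-1 is analytic at y := phi x0: for some n, U contains the
   preimage of the ball y + p ^ n Z_p ^ r, f maps this preimage into V, and each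
   coordinate of h (y + p ^ n z) is a power series in z over Q_p converging on
   Z_p ^ r. Such a series has bounded coefficients, so it is p ^ - k times a
   series over Z_p. *)
Definition analytic_at (p : nat) (X Y : Type) (r s : nat)
    (U : set X) (phi : X -> 'rV[padic_int p]_r)
    (V : set Y) (psi : Y -> 'rV[padic_int p]_s) (f : X -> Y) (x0 : X) : Prop :=
  exists (n k : nat) (c : 'I_s -> {ffun 'I_r -> nat} -> padic_int p),
  forall z : 'rV[padic_int p]_r, exists x : X,
  [/\ U x, V (f x), phi x = phi x0 + (p ^ n)%:R *: z
    & forall i, power_series_at (c i) z ((p ^ k)%:R * psi (f x) 0 i)].

(* A homeomorphism from an open subset of X onto an open subset of Z_p ^ m. *)
Record chart (p : nat) (X : topologicalType) (m : nat) := Chart {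
  chart_dom : set X;
  chart_map :> X -> 'rV[padic_int p]_m;
  chart_dom_open : open chart_dom;
  chart_continuous : forall x, chart_dom x -> {for x, continuous chart_map};
  chart_inj : forall x y, chart_dom x -> chart_dom y ->
    chart_map x = chart_map y -> x = y;
  chart_open : forall U, open U -> U `<=` chart_dom -> open (chart_map @` U)
}.

Definition analytic_atlas (p : nat) (X : topologicalType) (m : nat)
    (A : set (chart p X m)) : Prop :=
  (forall x, exists2 c, A c & chart_dom c x) /\
  forall c d x, A c -> A d -> chart_dom c x -> chart_dom d x ->
    analytic_at (chart_dom c) c (chart_dom d) d id x.

(* G has a structure of p-adic analytic manifold of dimension m for which the
   multiplication and the inverse are analytic. *)
Definition analytic_group_dim (p : nat) (G : topGroupType) (m : nat) : Prop :=
  exists A : set (chart p G m),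
  [/\ analytic_atlas A,
      (forall c d e x y, A c -> A d -> A e ->
         chart_dom c x -> chart_dom d y -> chart_dom e (x * y)%g ->
         analytic_at (chart_dom c `*` chart_dom d)
           (fun xy => row_mx (c xy.1) (d xy.2)) (chart_dom e) e
           (fun xy => (xy.1 * xy.2)%g) (x, y))
    & (forall c d x, A c -> A d -> chart_dom c x -> chart_dom d (x^-1)%g ->
         analytic_at (chart_dom c) c (chart_dom d) d (fun y => y^-1%g) x)].

(* Main.v *)
Require Import Defs.
From Stdlib Require List.
From HB Require Import structures.
From mathcomp Require Import all_boot all_order all_algebra all_fingroup.
From mathcomp Require Import all_solvable finmap.
From mathcomp Require Import ring zify.
From mathcomp Require Import boolp classical_sets functions cardinality.
From mathcomp Require Import topology.

(** Let [q] be [p], or 4 if [p = 2]. Fix [p]-adic exponents [eps i] with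
    [eps 0 = 1] and let a one-unit [t = 1 + q s] act on [Z_p] in the [i]-th
    coordinate by [t ^ eps i]. The semidirect product of the group of one-units
    with the translations is a metabelian group [aff] on [Z_p ^ m]; in the
    coordinate [s] of the one-unit, its law is
    [(v * w) i = v i + (1 + q v 0) ^ eps i * w i] for all [i], including [i = 0].
    Powers of one-units with [p]-adic exponents are computed modulo each [p ^ n]
    with natural exponents, and everything about them follows from lifting the
    exponent ([dvd_geo]).

    The group is uniform: commutators are translations by multiples of [q], and
    these are [q]-th powers of translations ([aff_uniform]). It is analytic since
    [(1 + q x + q z) ^ e] is a binomial series in [z] ([aff_analytic]).

    For the exponents [1, 1, lam, ..., lam], an isomorphism between open subgroups
    preserves translations and is linear on them, so it matches the eigenvalues
    [t] and [t ^ lam] of the action of some [t] with the eigenvalues [t'] and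
    [t' ^ mu] of the action of some [t']. As a one-unit other than 1 determines
    the exponents of its powers, [lam = mu] or [lam * mu = 1] or [1] is among
    [lam], [mu]; when [p] divides both exponents only [lam = mu] is possible
    ([fam_commensurable]). The multiples of [p] are uncountable.

    On the number of relations. A presentation with one relation for each pair
    [i < j] is obtained from a free pro-[p] group, constructed here as the closure
    of the words in the product of all marked finite [p]-groups
    ([free_pro_p_exists]): the relation for [(i, j)] says that [e i] conjugates
    [e j] to a [p]-adic power of [e j], so modulo the relations every element is a
    product of elements of the procyclic groups generated by the [e j], in
    decreasing order of [j], and on such products the map to [aff] is injective
    ([aff_presentation]). Conversely, fewer relations never suffice: a free pro-[p]
    group mapping onto [aff] also maps to the finite group [heisenberg] of class
    two, and there the relators must span a central subgroup whose rank is the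
    number of pairs ([aff_rels_ge]). *)

Set Implicit Arguments.
Unset Strict Implicit.
Unset Printing Implicit Defensive.

Import GRing.Theory.
Local Open Scope classical_set_scope.

(** * Topological groups *)

Section TopologicalGroups.
Local Open Scope card_scope.
Local Open Scope group_scope.
Variable G : topGroupType.
Implicit Types (A H N U : set G) (x y g h : G).

Lemma subgroup1 H : subgroup H -> H 1. Proof. by case. Qed.

Lemma subgroupV H x : subgroup H -> H x -> H x^-1.
Proof. by case=> H1 Hd Hx; rewrite -[x^-1]mul1g; apply: Hd. Qed.

Lemma subgroupM H x y : subgroup H -> H x -> H y -> H (x * y).
Proof.
by move=> sH Hx Hy; rewrite -[y]invgK; apply: sH.2 => //; apply: subgroupV.
Qed.

Lemma subgroupX H x n : subgroup H -> H x -> H (x ^+ n).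
Proof.
move=> sH Hx; elim: n => [|n IHn]; first exact: subgroup1.
by rewrite expgS; apply: subgroupM.
Qed.

Lemma smallest_subgroup A : subgroup (smallest (@subgroup G) A).
Proof.
split=> [C [[]]|x y Sx Sy C CA] //.
by apply: CA.1.2; [apply: Sx | apply: Sy].
Qed.

Lemma smallest_normal A : normal_subgroup (smallest (@normal_subgroup G) A).
Proof.
split; first split=> [C [[[]]]|x y Sx Sy C CA] //.
  by apply: CA.1.1.2; [apply: Sx | apply: Sy].
by move=> x g Sx C CA; apply: CA.1.2; apply: Sx.
Qed.

Lemma mulg_nbhs x y U : nbhs (x * y) U ->
  exists A B, [/\ nbhs x A, nbhs y B & forall a b, A a -> B b -> U (a * b)].
Proof.
move=> /(@mulg_continuous G (x, y)) [[A B] [/= nA nB] sAB].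
by exists A, B; split=> // a b Aa Bb; exact: (sAB (a, b)).
Qed.

Lemma mulgl_continuous x : continuous (fun y => x * y).
Proof.
move=> y U /mulg_nbhs[A [B [nA nB sAB]]]; apply: filterS nB => b Bb.
exact: sAB (nbhs_singleton nA) Bb.
Qed.

Lemma mulgr_continuous y : continuous (fun x => x * y).
Proof.
move=> x U /mulg_nbhs[A [B [nA nB sAB]]]; apply: filterS nA => a Aa.
exact: sAB Aa (nbhs_singleton nB).
Qed.

Lemma conjg_continuous g : continuous (fun x : G => x ^ g).
Proof.
move=> x; apply: (@continuous_comp _ _ _ (fun x => x * g) (fun x => g^-1 * x)).
  exact: mulgr_continuous.
exact: mulgl_continuous.
Qed.

Lemma closure_subgroup H : subgroup H -> subgroup (closure H).
Proof.
move=> sH; split=> [|x y Hx Hy U]; first by apply: subset_closure; apply: subgroup1.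
move=> /mulg_nbhs[A [B [/Hx[a [Ha Aa]] nB sAB]]].
have /Hy[b [Hb Bb]] : nbhs y [set b | B b^-1] by apply: invg_continuous.
by exists (a * b^-1); split; [apply: sH.2 | apply: sAB].
Qed.

Lemma closure_normal N : normal_subgroup N -> normal_subgroup (closure N).
Proof.
move=> [sN nN]; split; first exact: closure_subgroup.
move=> x g Nx U /(@conjg_continuous g x) /Nx[y [Ny Uy]].
by exists (y ^ g); split; [apply: nN | apply: Uy].
Qed.

Lemma closed_gen_subgroup A : subgroup (closed_gen A).
Proof. by apply: closure_subgroup; apply: smallest_subgroup. Qed.

Lemma sub_closed_gen A : A `<=` closed_gen A.
Proof. by move=> x Ax; apply: subset_closure; apply: sub_gen_smallest. Qed.

Lemma closed_gen_sub A H :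
  subgroup H -> closed H -> A `<=` H -> closed_gen A `<=` H.
Proof.
move=> sH cH sAH; rewrite (closure_id H).1 //; apply: closureS.
exact: smallest_sub.
Qed.

Lemma closed_normal_closure_normal A :
  normal_subgroup (closed_normal_closure A).
Proof. by apply: closure_normal; apply: smallest_normal. Qed.

Lemma sub_closed_normal_closure A : A `<=` closed_normal_closure A.
Proof. by move=> x Ax; apply: subset_closure; apply: sub_gen_smallest. Qed.

Lemma closed_normal_closure_sub A N : normal_subgroup N -> closed N ->
  A `<=` N -> closed_normal_closure A `<=` N.
Proof.
move=> sN cN sAN; rewrite (closure_id N).1 //; apply: closureS.
exact: smallest_sub.
Qed.

Lemma open_mull H x : open H -> open [set y | H (x * y)].
Proof. by apply: open_comp => y _; apply: mulgl_continuous. Qed.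

Lemma nbhs_coset H x : subgroup H -> open H -> nbhs x [set y | H (x^-1 * y)].
Proof.
move=> sH oH; apply: open_nbhs_nbhs; split; first exact: open_mull.
by rewrite /= mulVg; apply: subgroup1.
Qed.

Lemma compact_coset_reps H : compact [set: G] -> subgroup H -> open H ->
  exists r : seq G, forall x, exists2 g, g \in r & H (g^-1 * x).
Proof.
move=> /compact_near_coveringP cG sH oH.
(* Near covering, for the filter of the large enough finite sets. *)
pose large (s : seq G) := [set s' : seq G | {subset s <= s'}].
pose F := filter_from [set: seq G] large.
have FF : Filter F.
  apply: filter_from_filter => [|s t _ _]; first by exists [::].
  exists (s ++ t) => // s' st; split=> x xs; apply: st;
    by rewrite mem_cat xs ?orbT.
pose P (s : seq G) x := exists2 g, g \in s & H (g^-1 * x).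
have [|s0 _ Hs0] := cG _ F P FF; last by exists s0 => x; apply: Hs0.
move=> x _; exists ([set y | H (x^-1 * y)], large [:: x]) => /=.
  by split; [apply: nbhs_coset | exists [:: x]].
by move=> [y s] /= [Hxy xs]; exists x => //; apply: xs; apply: mem_head.
Qed.

(** A finite set of coset representatives suffices to define the core of [H],
    which is therefore open. *)
Lemma open_normal_core H : compact [set: G] -> subgroup H -> open H ->
  exists N, [/\ normal_subgroup N, open N & N `<=` H].
Proof.
move=> cG sH oH; have [r rP] := compact_coset_reps cG sH oH.
exists [set x | forall g, H (x ^ g)]; split; last 1 first.
- by move=> x /(_ 1); rewrite conjg1.
- split; last by move=> x g Hx h /=; rewrite -conjgM; apply: Hx.
  split=> [g|x y Hx Hy g]; first by rewrite conj1g; apply: subgroup1.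
  by rewrite conjMg conjVg; apply: sH.2; [apply: Hx | apply: Hy].
suff -> : [set x | forall g, H (x ^ g)] = [set x | forall g, g \in r -> H (x ^ g)].
  elim: r {rP} => [|g r IHr].
    by rewrite (_ : [set _ | _] = setT); [exact: openT | apply/seteqP; split].
  rewrite (_ : [set _ | _] = [set x | H (x ^ g)] `&`
    [set x | forall g, g \in r -> H (x ^ g)]).
    by apply: openI => //; apply: open_comp oH => x _; apply: conjg_continuous.
  apply/seteqP; split=> [x Hx|x [Hxg Hx] h]; last first.
    by rewrite inE => /predU1P[->|/Hx].
  by split=> [|h hr]; apply: Hx; rewrite inE ?eqxx ?hr ?orbT.
apply/seteqP; split=> x Hx g; first by move=> _; apply: Hx.
have [h hr Hhg] := rP g; rewrite -(mulVKg h g) conjgM conjgE.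
have Hxh := Hx h hr.
by apply: subgroupM; [|apply: subgroupV|apply: subgroupM].
Qed.

Lemma compact_finite_index H : compact [set: G] -> subgroup H -> open H ->
  exists K, left_cosets H #= `I_K.
Proof.
move=> cG sH oH; have [r rP] := compact_coset_reps cG sH oH.
apply: (sub_finite_set _ (finite_image (fun g => [set (g * h) | h in H])
  (finite_seq r))).
move=> _ [x _ <-]; have [g gr Hgx] := rP x; exists g => //=.
apply/seteqP; split=> _ [h Hh <-].
  exists ((g^-1 * x)^-1 * h); last by rewrite invgM invgK !mulgA mulgV mul1g.
  by apply: subgroupM => //; apply: subgroupV.
exists (g^-1 * x * h); first exact: subgroupM.
by rewrite !mulgA mulgV mul1g.
Qed.

Lemma coset_index H K : subgroup H -> left_cosets H #= `I_K ->
  exists (k : G -> 'I_K) (r : 'I_K -> G),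
    (forall g h, k g = k h <-> H (g^-1 * h)) /\ cancel r k.
Proof.
move=> sH /card_set_bijP[f [ff fi fs]].
pose co g := [set (g * h) | h in H].
have coP g h : co g = co h <-> H (g^-1 * h).
  split=> [gh|Hgh].
    have : co h h by exists 1; [apply: subgroup1 | rewrite mulg1].
    by rewrite -gh => -[x Hx <-]; rewrite mulKg.
  apply/seteqP; split=> _ [x Hx <-].
    exists ((g^-1 * h)^-1 * x); last by rewrite invgM invgK !mulgA mulgV mul1g.
    by apply: subgroupM => //; apply: subgroupV.
  exists (g^-1 * h * x); first exact: subgroupM.
  by rewrite !mulgA mulgV mul1g.
have fK g : (f (co g) < K)%N by apply: ff; exists g.
pose k g := Ordinal (fK g).
have ksurj i : exists g, k g = i.
  have [_ [g _ <-] fg] := fs i (ltn_ord i); exists g; exact: val_inj.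
exists k, (fun i => projT1 (cid (ksurj i))); split=> [g h|i]; last first.
  by case: (cid _).
split=> [[]|/coP gh]; last by apply: val_inj; rewrite /= gh.
by move=> /fi gh; apply/coP/gh; rewrite inE; [exists g | exists h].
Qed.

(** The right regular representation of the quotient by [N] turns it into a
    finite permutation group, to which Lagrange's and Cauchy's theorems apply. *)
Lemma finite_quotient N K : normal_subgroup N -> left_cosets N #= `I_K ->
  exists (R : {group 'S_K}) (rho : G -> 'S_K),
  [/\ #|R| = K, {morph rho : x y / x * y}, (forall g, rho g \in R),
      (forall s, s \in R -> exists g, rho g = s)
    & forall g, rho g = 1 <-> N g].
Proof.
move=> [sN nN] /(coset_index sN)[k [r [kP rK]]].
have act_inj g : injective (fun i => k (r i * g)).
  move=> i j /kP; rewrite invgM -mulgA (mulgA (r i)^-1) -{2}(invgK g) => Nij.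
  rewrite -(rK i) -(rK j); apply/kP.
  by rewrite -(mulgK g (_ * _)) -(mulgA _ g); move: (nN _ g^-1 Nij);
    rewrite conjgE invgK !mulgA mulgV mul1g mulgK.
pose rho g := perm (@act_inj g).
have rkN x : N ((r (k x))^-1 * x) by apply/kP; rewrite rK.
have kMr x y g : k x = k y -> k (x * g) = k (y * g).
  move=> /kP Nxy; apply/kP; rewrite invgM -mulgA (mulgA _ y) -conjgE.
  exact: nN.
have kMl x y g : k x = k y -> k (g * x) = k (g * y).
  by move=> /kP Nxy; apply/kP; rewrite invgM -mulgA mulKg.
have rhoM : {morph rho : x y / x * y}.
  move=> x y; apply/permP => i; rewrite permM !permE mulgA; apply: kMr.
  by rewrite rK.
have rhoE g h : (rho g == rho h) = (k g == k h).
  apply/eqP/eqP => [/permP/(_ (k 1))|gh].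
    have k1 x : k (r (k 1) * x) = k x.
      by rewrite -[in RHS](mul1g x); apply: kMr; rewrite rK.
    by rewrite !permE !k1.
  by apply/permP => i; rewrite !permE; apply: kMl.
have rho1 : rho 1 = 1 by apply/permP => i; rewrite permE perm1 mulg1 rK.
pose R0 := finset (fun s => [exists i, s == rho (r i)]).
have R0P s : reflect (exists g, rho g = s) (s \in R0).
  rewrite inE; apply: (iffP existsP) => [[i /eqP ->]|[g <-]]; first by exists (r i).
  by exists (k g); rewrite rhoE rK.
have R0g : group_set R0.
  apply/group_setP; split=> [|s t /R0P[x <-] /R0P[y <-]].
    by apply/R0P; exists 1.
  by apply/R0P; exists (x * y).
exists (Group R0g), rho; split=> // [|g|s /R0P //|g]; last 2 first.
- by apply/R0P; exists g.
- rewrite -rho1; split=> [/eqP|Ng]; first by rewrite rhoE eq_sym => /eqP/kP;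
    rewrite invg1 mul1g.
  by apply/eqP; rewrite rhoE eq_sym; apply/eqP/kP; rewrite invg1 mul1g.
rewrite (_ : #|_| = #|((fun i => rho (r i)) @: 'I_K)%SET|).
  by rewrite card_imset ?card_ord // => i j /eqP; rewrite rhoE !rK => /eqP.
apply: eq_card => s; apply/R0P/imsetP => [[g <-]|[i _ ->]]; last by exists (r i).
by exists (k g) => //; apply/eqP; rewrite rhoE rK.
Qed.

Lemma morphX_group (gT : finGroupType) (rho : G -> gT) x n :
  {morph rho : x y / x * y} -> rho 1 = 1 -> rho (x ^+ n) = rho x ^+ n.
Proof. by move=> rhoM rho1; elim: n => // n IHn; rewrite !expgS rhoM IHn. Qed.

Lemma pro_p_exponent p N : pro_p p G -> normal_subgroup N -> open N ->
  exists k, forall x, N (x ^+ (p ^ k)).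
Proof.
case=> cG _ _ pG nN oN; have [k Nk] := pG N nN oN; exists k => x.
have [R [rho [cR rhoM rhoR _ kerN]]] := finite_quotient nN Nk.
apply/kerN; rewrite morphX_group //; last by apply/kerN; apply: subgroup1 nN.1.
by rewrite -[in X in _ ^+ X]cR expg_cardG.
Qed.

(** Apply Cauchy's theorem to the finite quotients. *)
Lemma pro_p_criterion p : prime p ->
  compact [set: G] -> hausdorff_space G ->
  (forall U, nbhs 1 U -> exists H, [/\ subgroup H, open H & H `<=` U]) ->
  (forall N x, normal_subgroup N -> open N -> exists k, N (x ^+ (p ^ k))) ->
  pro_p p G.
Proof.
move=> p_pr cG hG bG ordG; split=> // N nN oN.
have [K NK] := compact_finite_index cG nN.1 oN.
have [R [rho [cR rhoM _ Rrho kerN]]] := finite_quotient nN NK.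
have rho1 : rho 1 = 1 by apply/kerN; apply: subgroup1 nN.1.
have /p_natP[k kE] : p.-nat K.
  rewrite -cR; apply/(pgroupP (pi := p) (G := R)) => q q_pr /(Cauchy q_pr)[s Rs qE].
  have [g gs] := Rrho s Rs; have [k Nk] := ordG N g nN oN.
  have : (q %| p ^ k)%N.
    by rewrite -qE order_dvdn -gs -morphX_group //; apply/eqP/kerN.
  by rewrite Euclid_dvdX // => /andP[+ _]; rewrite dvdn_prime2.
by exists k; rewrite -kE.
Qed.

End TopologicalGroups.

Section HomFacts.
Local Open Scope group_scope.
Variables (F G : topGroupType) (f : F -> G).
Hypothesis fM : {morph f : x y / x * y}.

Lemma hom_one : f 1 = 1.
Proof. by apply: (@mulgI _ (f 1)); rewrite -fM !mulg1. Qed.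

Lemma hom_inv x : f x^-1 = (f x)^-1.
Proof. by apply: (@mulgI _ (f x)); rewrite -fM !mulgV hom_one. Qed.

Lemma hom_exp x n : f (x ^+ n) = f x ^+ n.
Proof. by elim: n => [|n IHn]; rewrite ?hom_one // !expgS fM IHn. Qed.

Lemma hom_conj x y : f (x ^ y) = f x ^ f y.
Proof. by rewrite !conjgE !fM hom_inv. Qed.

Lemma hom_comm x y : f [~ x, y] = [~ f x, f y].
Proof. by rewrite !commgEl fM hom_inv hom_conj. Qed.

End HomFacts.

Section OpenMapping.
Local Open Scope group_scope.

(** The saturation of an open set by the kernel is open; its complement is
    compact, hence has a closed image. *)
Lemma compact_hom_open (F G : topGroupType) (f : F -> G) :
  compact [set: F] -> hausdorff_space G -> continuous_hom f ->
  range f = [set: G] -> forall U, open U -> open (f @` U).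
Proof.
move=> cF hG [fM fc] fS U oU.
pose S := \bigcup_(r in [set r | f r = 1]) [set x | U (r * x)].
have oS : open S by apply: bigcup_open => r _; apply: open_mull.
have SE : f @` U = ~` (f @` (~` S)).
  apply/seteqP; split=> [_ [x Ux <-] [y NSy yx]|y Ny].
    apply: NSy; exists (x * y^-1); last by rewrite /= mulgVK.
    by rewrite /= fM (hom_inv fM) yx mulgV.
  have [x _ xy] : range f y by rewrite fS.
  apply: contrapT => NUy; apply: Ny; exists x => // -[r /= fr Urx].
  by apply: NUy; exists (r * x) => //; rewrite fM fr mul1g.
rewrite SE; apply: closed_openC; apply: compact_closed => //.
apply: continuous_compact; first exact: continuous_subspaceT.
by apply: subclosed_compact cF _ => //; apply: open_closedC.
Qed.

End OpenMapping.

(** * Profinite spaces *)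

Definition agree (I X : Type) (c : I -> X -> nat) (s : seq I) (x y : X) :=
  forall i, List.In i s -> c i y = c i x.

(** A space whose points are determined by coordinates in finite sets. An
    ultrafilter selects a value of each coordinate, and the point with these
    coordinates is its limit. *)
Section Coordinates.
Variables (X : topologicalType) (I : Type) (c : I -> X -> nat) (b : I -> nat).

Hypothesis nbhs_agree : forall x U,
  nbhs x U <-> exists s, forall y, agree c s x y -> U y.
Hypothesis c_bounded : forall i x, (c i x < b i)%N.

Lemma coordinates_compact :
  (forall a : I -> nat,
     (forall s, exists x, forall i, List.In i s -> c i x = a i) ->
     exists x, forall i, c i x = a i) ->
  compact [set: X].
Proof.
move=> cX; rewrite compact_ultra => F UF _.
have val_ex i : exists a, F [set x | c i x = a].
  have : F [set x | (c i x < b i)%N].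
    by apply: filterE => x /=; apply: c_bounded.
  elim: (b i) => [|k IHk] Fk.
    by have [x] := filter_ex Fk.
  have [Fik|NFik] := in_ultra_setVsetC [set x | c i x = k] UF; first by exists k.
  apply: IHk; apply: filterS (filterI Fk NFik) => x /= [].
  by rewrite ltnS leq_eqVlt => /predU1P[].
pose a i := projT1 (cid (val_ex i)).
have aF i : F [set x | c i x = a i] by rewrite /a; case: (cid _).
have aFs s : F [set x | forall i, List.In i s -> c i x = a i].
  elim: s => [|i s IHs]; first by apply: filterE => x i [].
  apply: filterS (filterI (aF i) IHs) => x /= [ci cs] j [<-//|].
  exact: cs.
have [s|x xa] := cX a; first by apply: filter_ex (aFs s).
exists x; split=> // U /nbhs_agree[s sU]; apply: filterS (aFs s) => y ya.
by apply: sU => i si; rewrite xa ya.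
Qed.

Lemma coordinates_hausdorff :
  (forall x y, (forall i, c i x = c i y) -> x = y) -> hausdorff_space X.
Proof.
move=> cI x y xy; apply: cI => i.
have nx z : nbhs z [set t | c i t = c i z].
  by apply/nbhs_agree; exists [:: i] => t; apply; left.
by have [t [/= <- <-]] := xy _ _ (nx x) (nx y).
Qed.

End Coordinates.

Local Open Scope ring_scope.

(** * Lifting the exponent *)

Section GeometricSums.
Variable R : comPzRingType.
Implicit Types (u : R) (a b j : nat).

Definition geo u j : R := \sum_(i < j) u ^+ i.

Lemma geo0 u : geo u 0 = 0.
Proof. by rewrite /geo big_ord0. Qed.

Lemma geoS u j : geo u j.+1 = 1 + u * geo u j.
Proof.
rewrite /geo big_ord_recl expr0 mulr_sumr; congr (_ + _).
by apply: eq_bigr => i _; rewrite exprS.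
Qed.

Lemma geo_one j : geo 1 j = j%:R.
Proof. by elim: j => [|j IHj]; rewrite ?geo0 // geoS IHj mul1r mulrS. Qed.

Lemma geo_sub1 u j : u ^+ j = 1 + (u - 1) * geo u j.
Proof.
elim: j => [|j IHj]; first by rewrite geo0 mulr0 addr0.
by rewrite exprS {}IHj geoS !mulrDr !mulrDl !mulN1r !mulr1; ring.
Qed.

Lemma geoD u a b : geo u (a + b) = geo u a + u ^+ a * geo u b.
Proof.
elim: a => [|a IHa]; first by rewrite geo0 add0r mul1r.
by rewrite addSn !geoS IHa exprS; ring.
Qed.

Lemma geoM u a b : geo u (a * b) = geo u a * geo (u ^+ a) b.
Proof.
elim: b => [|b IHb]; first by rewrite muln0 !geo0 mulr0.
by rewrite mulnS geoD IHb geoS; ring.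
Qed.

End GeometricSums.

(** Stated in an arbitrary commutative ring because it serves both for integers
    and for polynomials with integer coefficients. *)
Section Congruence.
Variable R : comPzRingType.
Implicit Types (u v w x y : R) (d a b n : nat).

Definition cong d u v := exists w, u = v + d%:R * w.

Lemma cong_refl d u : cong d u u.
Proof. by exists 0; rewrite mulr0 addr0. Qed.

Lemma cong_sym d u v : cong d u v -> cong d v u.
Proof. by case=> w ->; exists (- w); ring. Qed.

Lemma cong_trans d u v w : cong d u v -> cong d v w -> cong d u w.
Proof. by case=> x -> [y ->]; exists (x + y); ring. Qed.

Lemma congD d u v x y : cong d u v -> cong d x y -> cong d (u + x) (v + y).
Proof. by case=> a -> [b ->]; exists (a + b); ring. Qed.

Lemma congM d u v x y : cong d u v -> cong d x y -> cong d (u * x) (v * y).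
Proof. by case=> a -> [b ->]; exists (v * b + a * y + d%:R * a * b); ring. Qed.

Lemma congX d u v n : cong d u v -> cong d (u ^+ n) (v ^+ n).
Proof.
move=> uv; elim: n => [|n IHn]; first exact: cong_refl.
by rewrite !exprS; apply: congM.
Qed.

Lemma cong_dvd d d' u v : (d %| d')%N -> cong d' u v -> cong d u v.
Proof. by case/dvdnP=> k -> [w ->]; exists (k%:R * w); rewrite natrM; ring. Qed.

Lemma geo_expand u j : exists w,
  geo u j = j%:R + 'C(j, 2)%:R * (u - 1) + (u - 1) ^+ 2 * w.
Proof.
elim: j => [|j [w IHj]]; first by exists 0; rewrite geo0 bin0n /=; ring.
exists (u * w + 'C(j, 2)%:R); rewrite geoS IHj binS bin1 natrD mulrS; ring.
Qed.

Lemma cong_geo d u j : cong d u 1 -> cong d (geo u j) j%:R.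
Proof.
case=> x uE; have [w ->] := geo_expand u j.
exists (x * ('C(j, 2)%:R + (u - 1) * w)).
by rewrite [in RHS]mulrA (_ : d%:R * x = u - 1); [ring | rewrite uE; ring].
Qed.

(** Each power gains a factor [p], because [1 + w + ... + w ^ (p - 1)] is
    divisible by [p] when [w = 1] modulo [p]. *)
Lemma cong_expX p n u : cong p u 1 -> cong (p ^ n.+1) (u ^+ (p ^ n)) 1.
Proof.
move=> u1; elim: n => [|n [x IHn]]; first by rewrite expn1.
have [|y gE] := @cong_geo p (u ^+ (p ^ n)) p.
  by apply: cong_dvd (ex_intro _ x IHn); rewrite dvdn_exp.
rewrite [in u ^+ _]expnSr exprM geo_sub1 gE {1}IHn [(p ^ n.+2)%N]expnSr.
by exists (x * (1 + y)); rewrite natrM; ring.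
Qed.

(** This makes powers of one-units with [p]-adic exponents well defined. *)
Lemma cong_exp p n u v a b : cong p u 1 -> cong (p ^ n) u v ->
  a = b %[mod p ^ n] -> cong (p ^ n) (u ^+ a) (v ^+ b).
Proof.
move=> u1 uv ab; apply: cong_trans (congX b uv).
have {v uv} u1n c : cong (p ^ n) (u ^+ (p ^ n * c)) 1.
  rewrite exprM -[X in cong _ _ X](expr1n _ c); apply: congX.
  by apply: cong_dvd (cong_expX n u1); rewrite expnS dvdn_mull.
have red c : cong (p ^ n) (u ^+ c) (u ^+ (c %% p ^ n)).
  rewrite {1}(divn_eq c (p ^ n)) exprD mulnC -[X in cong _ _ X]mul1r.
  by apply: congM; [apply: u1n | apply: cong_refl].
by apply: cong_trans (red a) _; rewrite ab; apply/cong_sym/red.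
Qed.

End Congruence.

Lemma congz d (u v : int) : cong d u v <-> (u = v %[mod d])%Z.
Proof.
split=> [[w ->]|/eqP]; first by rewrite mulrC natz addrC modzMDl.
rewrite eqz_mod_dvd => /dvdzP[w E]; exists w.
by rewrite mulrC natz -E addrC subrK.
Qed.

Section Arithmetic.
Variables (p : nat) (p_pr : prime p).

Definition qexp : nat := if p == 2%N then 2 else 1.

Definition qpow : nat := if p == 2%N then 4 else p.

Lemma qpowE : qpow = (p ^ qexp)%N.
Proof. by rewrite /qpow /qexp; case: (p =P 2%N) => [->|_]; rewrite ?expn1. Qed.

Lemma dvdp_q : (p %| qpow)%N.
Proof. by rewrite qpowE dvdn_exp // /qexp; case: ifP. Qed.

Lemma dvd_q_bin2 : (p * p %| qpow * 'C(p, 2))%N.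
Proof.
rewrite /qpow; case: (p =P 2%N) => [->//|/eqP p2].
by rewrite dvdn_pmul2l ?prime_gt0 // prime_dvd_bin //= ltn_neqAle eq_sym p2 prime_gt1.
Qed.

(** The second order expansion of the sum shows that it is [p] modulo [p ^ 2];
    for [p = 2] this needs [u = 1] modulo 4. *)
Lemma geo_p (u : int) : cong qpow u 1 -> exists2 c, geo u p = p%:Z * c & ~~ (p %| c)%Z.
Proof.
case=> x uE; have [w gE] := geo_expand u p.
have /dvdnP[k kE] := dvd_q_bin2; have /dvdnP[l lE] := dvdp_q.
exists (1 + p%:R * (k%:R * x + l%:R ^+ 2 * x ^+ 2 * w)).
  have E : 'C(p, 2)%:R * (u - 1) = p%:R * p%:R * (k%:R * x) :> int.
    have kE' : qpow%:R * 'C(p, 2)%:R = k%:R * (p%:R * p%:R) :> int.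
      by rewrite -!natrM kE.
    transitivity (qpow%:R * 'C(p, 2)%:R * x); first by rewrite uE; ring.
    by rewrite kE'; ring.
  by rewrite gE E uE lE natrM -[Posz p]natz; ring.
rewrite (natz p); set w' := (k%:R * x + _); apply/negP => pw'.
have : (p %| (1 + p%:Z * w') - p%:Z * w')%Z by apply: rpredB => //; apply: dvdz_mulr.
by rewrite addrK dvdz1 absz_nat; case: p p_pr => [|[]].
Qed.

(** Lifting the exponent, by induction on [k]: each factor [p] of [j] contributes
    a factor [geo u p], which is [p] times a unit, and replaces [u] by [u ^ p]. *)
Lemma dvd_geo k (u : int) j :
  cong qpow u 1 -> ((p ^ k)%N %| geo u j)%Z = (p ^ k %| j)%N.
Proof.
elim: k u j => [|k IHk] u j u1; first by rewrite dvd1z dvd1n.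
have [/dvdnP[i ->]|pj] := boolP (p %| j)%N; last first.
  have npj : (p ^ k.+1 %| j)%N = false.
    by apply: contraNF pj; apply: dvdn_trans; rewrite dvdn_exp.
  rewrite npj; apply: contraNF pj => pg; have := cong_geo j (cong_dvd dvdp_q u1).
  move=> /congz; rewrite natz => E; have : (p %| geo u j)%Z.
    by apply: dvdz_trans pg; rewrite expnS PoszM dvdz_mulr.
  by move/dvdz_mod0P; rewrite E => /dvdz_mod0P.
rewrite mulnC geoM expnS; have [c -> pc] := geo_p u1.
have p0 : p != 0%N by rewrite -lt0n prime_gt0.
rewrite dvdn_pmul2l ?prime_gt0 // PoszM -mulrA dvdz_mul2l //.
rewrite Gauss_dvdzr ?IHk //.
  by rewrite -[X in cong _ _ X](expr1n _ p); apply: congX.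
rewrite /coprimez /gcdz absz_nat; apply/eqP; congr Posz; apply/eqP.
by rewrite -/(coprime _ _) coprimeXl // prime_coprime.
Qed.

End Arithmetic.

(** * Powers of one-units of the p-adic integers *)

Section Residues.
Variable p : nat.
Implicit Types (x y z : padic_int p) (a b : int) (n k : nat).

(** As this relation is stable under the ring operations, identities between
    [p]-adic integers reduce to identities between integers at each level. *)
Definition rep n x a := x n = (a %% (p ^ n)%N)%Z.

Lemma rep_refl n x : rep n x (x n).
Proof. by rewrite /rep pval_mod. Qed.

Lemma rep_le m n x : (m <= n)%N -> rep m x (x n).
Proof.
move=> mn; rewrite /rep -(subnK mn).
elim: (n - m)%N => [|d IHd]; first by rewrite add0n pval_mod.
rewrite IHd (pval_coherent x (d + m)) /= addSn.
apply/eqP; rewrite eqz_mod_dvd; apply: (@dvdz_trans (p ^ (d + m))%N).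
  by rewrite expnD PoszM dvdz_mull.
by rewrite -eqz_mod_dvd modz_mod.
Qed.

Lemma repD n x y a b : rep n x a -> rep n y b -> rep n (x + y) (a + b).
Proof. by rewrite /rep /= => -> ->; rewrite modzDm. Qed.

Lemma repN n x a : rep n x a -> rep n (- x) (- a).
Proof. by rewrite /rep /= => ->; rewrite modzNm. Qed.

Lemma repM n x y a b : rep n x a -> rep n y b -> rep n (x * y) (a * b).
Proof. by rewrite /rep /= => -> ->; rewrite modzMm. Qed.

Lemma rep0 n : rep n 0 0. Proof. by []. Qed.
Lemma pval0 n : (0 : padic_int p) n = 0. Proof. by rewrite (rep0 n) mod0z. Qed.
Lemma rep1 n : rep n 1 1. Proof. by []. Qed.

Lemma repX n x a k : rep n x a -> rep n (x ^+ k) (a ^+ k).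
Proof.
move=> xa; elim: k => [|k IHk]; first exact: rep1.
by rewrite !exprS; apply: repM.
Qed.

Lemma rep_nat n k : rep n k%:R k%:R.
Proof.
elim: k => [|k IHk]; first exact: rep0.
by rewrite !mulrS; apply: repD => //; apply: rep1.
Qed.

Lemma rep_sum n (I : Type) (r : seq I) (P : pred I) (F : I -> padic_int p) E :
  (forall i, rep n (F i) (E i)) ->
  rep n (\sum_(i <- r | P i) F i) (\sum_(i <- r | P i) E i).
Proof.
move=> FE; elim: r => [|i r IHr]; first by rewrite !big_nil.
by rewrite !big_cons; case: (P i) => //; apply: repD.
Qed.

Lemma rep_geo n x a k : rep n x a -> rep n (geo x k) (geo a k).
Proof. by move=> xa; apply: rep_sum => i; apply: repX. Qed.

Lemma rep_eq n x y a : rep n x a -> rep n y a -> x n = y n.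
Proof. by rewrite /rep => -> ->. Qed.

Lemma rep_eqP n x y a b : rep n x a -> rep n y b ->
  x n = y n <-> (a = b %[mod (p ^ n)%N])%Z.
Proof. by rewrite /rep => -> ->. Qed.

Lemma pval0_dvd n x a : rep n x a -> x n = 0 <-> ((p ^ n)%N %| a)%Z.
Proof. by rewrite /rep => ->; split=> /dvdz_mod0P. Qed.

Lemma pval_eq_sub n x y : x n = y n <-> (x - y) n = 0.
Proof.
split=> [xy|]; first by rewrite (repD (rep_refl n x) (repN (rep_refl n y))) xy subrr mod0z.
move=> xy0; have := repD (rep_refl n (x - y)) (rep_refl n y).
by rewrite xy0 subrK add0r /rep pval_mod.
Qed.

Lemma pvalM0 n x y : x n = 0 -> (x * y) n = 0.
Proof.
move=> x0; have x0' : rep n x 0 by rewrite /rep mod0z.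
by rewrite (repM x0' (rep_refl n y)) mul0r mod0z.
Qed.

Lemma pvalD0 n x y : x n = 0 -> y n = 0 -> (x + y) n = 0.
Proof.
by move=> x0 y0; rewrite (repD (rep_refl n x) (rep_refl n y)) x0 y0 addr0 mod0z.
Qed.

Lemma pvalD_congr n x x' y y' : x n = x' n -> y n = y' n -> (x + y) n = (x' + y') n.
Proof. by move=> /= -> ->. Qed.

Lemma pvalM_congr n x x' y y' : x n = x' n -> y n = y' n -> (x * y) n = (x' * y') n.
Proof. by move=> /= -> ->. Qed.

Lemma pvalN_congr n x x' : x n = x' n -> (- x) n = (- x') n.
Proof. by move=> /= ->. Qed.

End Residues.

Section Padic.
Variables (p : nat) (p_pr : prime p).
Notation Zp := (padic_int p).
Implicit Types (x y z s e : Zp) (n k : nat).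
Notation q := (qpow p).

Let pX_gt0 n : (0 < p ^ n)%N.
Proof. by rewrite expn_gt0 prime_gt0. Qed.

Let pXn0 n : (p ^ n)%N%:Z != 0.
Proof. by rewrite -lt0n pX_gt0. Qed.

Lemma pval_ge0 x n : (0 <= x n)%R.
Proof. by rewrite -pval_mod modz_ge0 ?pXn0. Qed.

Lemma pval_absz x n : `|x n|%N%:Z = x n.
Proof. by rewrite gez0_abs ?pval_ge0. Qed.

Lemma pval_lt x n : (`|x n| < p ^ n)%N.
Proof. by rewrite -ltz_nat pval_absz -pval_mod ltz_pmod ?ltz_nat ?pX_gt0. Qed.

Lemma rep_absz n x : rep n x `|x n|%N%:Z.
Proof. by rewrite pval_absz; apply: rep_refl. Qed.

Lemma mulpX_eq0 n x k : ((p ^ n)%:R * x) (n + k)%N = 0 <-> x k = 0.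
Proof.
have xnk : rep k x (x (n + k)%N) by apply: rep_le; rewrite leq_addl.
rewrite (pval0_dvd (repM (rep_nat p (n + k) (p ^ n)) (rep_refl _ x))).
by rewrite (pval0_dvd xnk) expnD PoszM natz dvdz_mul2l.
Qed.

Lemma padic_divX n x : x n = 0 -> exists y, x = (p ^ n)%:R * y.
Proof.
move=> x0.
have xd k : ((p ^ n)%N %| x (n + k)%N)%Z.
  by rewrite -(pval0_dvd (rep_le x (leq_addr k n))).
have cy : forall k, ((x (n + k.+1)%N %/ (p ^ n)%N)%Z =
    (x (n + k)%N %/ (p ^ n)%N)%Z %[mod (p ^ k)%N])%Z.
  move=> k; apply/eqP; rewrite eqz_mod_dvd -(@dvdz_mul2l (p ^ n)%N) // -PoszM -expnD.
  rewrite mulrBr ![_ * (_ %/ _)%Z]mulrC !divzK // -eqz_mod_dvd.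
  by rewrite pval_mod (rep_le x (leqnSn (n + k))) addnS.
exists (mk_padic cy); apply: padicP => k.
apply: (rep_eq (rep_le x (leq_addl n k))).
have := repM (rep_nat p k (p ^ n)) (erefl : rep k (mk_padic cy) _).
by rewrite natz [_%:Z * _]mulrC divzK.
Qed.

Lemma dvdz_pX_mul m n (a b : int) : ((p ^ (m + n))%N %| a * b)%Z ->
  ~~ ((p ^ m)%N %| a)%Z -> ((p ^ n)%N %| b)%Z.
Proof.
rewrite !dvdzE !absz_nat abszM; move: `|a|%N `|b|%N => {a b} a b.
have [->|b0] := posnP b; first by rewrite dvdn0.
have [->|a0] := posnP a; first by rewrite dvdn0.
rewrite !pfactor_dvdn ?muln_gt0 ?a0 // lognM // -ltnNge => mn am.
by lia.
Qed.

Lemma padic_neq0 x : x <> 0 -> exists n, x n <> 0.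
Proof.
move=> x0; apply: contrapT => xn; apply: x0; apply: padicP => n.
by rewrite pval0; apply: contrapT => ?; apply: xn; exists n.
Qed.

Lemma padic_mulf_eq0 x y : x * y = 0 -> x = 0 \/ y = 0.
Proof.
move=> xy0; have [->|/eqP x0] := eqVneq x 0; [by left | right].
have [a xa] := padic_neq0 x0.
apply: padicP => b; rewrite pval0; apply/(pval0_dvd (rep_le y (leq_addl a b))).
have := repM (rep_refl (a + b) x) (rep_refl (a + b) y).
rewrite xy0 => /pval0_dvd[/(_ (pval0 p _)) /dvdz_pX_mul + _]; apply; apply/negP.
by move=> /(pval0_dvd (rep_le x (leq_addr b a))).
Qed.

Lemma cong_unit (s : int) : cong q (1 + q%:R * s) 1.
Proof. by exists s. Qed.

Lemma geo_level s k j : (geo (1 + q%:R * s) j) k = 0 <-> (p ^ k %| j)%N.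
Proof.
have r := repD (rep1 p k) (repM (rep_nat p k q) (rep_refl k s)).
by rewrite (pval0_dvd (rep_geo j r)) dvd_geo //; apply: cong_unit.
Qed.

Lemma geo_neq0 s j : (0 < j)%N -> geo (1 + q%:R * s) j <> 0.
Proof.
move=> j0 g0; have := @geo_level s j j; rewrite g0 => -[/(_ (pval0 p _))/dvdn_leq].
by move=> /(_ j0); rewrite leqNgt ltn_expl // prime_gt1.
Qed.

Fact pexp_compatible s e n :
  ((1 + q%:R * s n.+1) ^+ `|e n.+1|%N = (1 + q%:R * s n) ^+ `|e n|%N %[mod (p ^ n)%N])%Z.
Proof.
apply/congz; apply: cong_exp; first exact: cong_dvd (dvdp_q p) (cong_unit _).
  apply: congD; first exact: cong_refl.
  by apply: congM; [exact: cong_refl | apply/congz; exact: pval_compatible].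
apply/eqP; rewrite -(eqz_nat) /= -!modz_nat !pval_absz; apply/eqP.
exact: pval_compatible.
Qed.

(** The power [(1 + q s) ^ e], computed modulo [p ^ n] with the natural number
    that represents [e] modulo [p ^ n]. *)
Definition pexp s e : Zp := mk_padic (pexp_compatible s e).

Lemma rep_pexp n s e (a : int) (b : nat) :
  rep n s a -> rep n e b%:Z -> rep n (pexp s e) ((1 + q%:R * a) ^+ b).
Proof.
move=> sa eb; rewrite /rep /=; apply/congz; apply: cong_exp.
- exact: cong_dvd (dvdp_q p) (cong_unit _).
- apply: congD; first exact: cong_refl.
  by apply: congM; [exact: cong_refl | apply/congz; rewrite sa modz_mod].
- apply/eqP; rewrite -(eqz_nat) /= -!modz_nat !pval_absz eb; apply/eqP.
  by rewrite modz_mod.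
Qed.

Lemma pexp_congr n s s' e : s n = s' n -> pexp s e n = pexp s' e n.
Proof. by move=> /= ->. Qed.

Lemma pexpD s a b : pexp s (a + b) = pexp s a * pexp s b.
Proof.
apply: padicP => n; have rs := rep_refl n s.
have [ra rb] := (rep_absz n a, rep_absz n b).
apply: (rep_eq (rep_pexp rs (repD ra rb))).
by rewrite exprD; apply: repM; apply: rep_pexp.
Qed.

Lemma pexp0 s : pexp s 0 = 1.
Proof. by apply: padicP => n; apply: (rep_eq (rep_pexp (rep_refl n s) (rep0 p n))). Qed.

Lemma pexp1 s : pexp s 1 = 1 + q%:R * s.
Proof.
apply: padicP => n; apply: (rep_eq (rep_pexp (rep_refl n s) (rep1 p n))).
by rewrite expr1; apply: repD (rep1 p n) (repM (rep_nat p n q) (rep_refl n s)).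
Qed.

Lemma pexp_zero e : pexp 0 e = 1.
Proof.
apply: padicP => n; apply: (rep_eq (rep_pexp (rep0 p n) (rep_absz n e))).
by rewrite mulr0 addr0 expr1n; apply: rep1.
Qed.

(** The operation on [s] and [t] is the product of the one-units [1 + q s] and
    [1 + q t]. *)
Lemma pexp_mul s t e : pexp (s + (1 + q%:R * s) * t) e = pexp s e * pexp t e.
Proof.
apply: padicP => n; have [rs rt] := (rep_refl n s, rep_refl n t).
have re := rep_absz n e.
have rst := repD rs (repM (repD (rep1 p n) (repM (rep_nat p n q) rs)) rt).
apply: (rep_eq (rep_pexp rst re)).
suff -> : 1 + q%:R * (s n + (1 + q%:R * s n) * t n) =
          (1 + q%:R * s n) * (1 + q%:R * t n) :> int.
  by rewrite exprMn; apply: repM; apply: rep_pexp.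
by ring.
Qed.

Lemma pexp_one_unit s e : exists y, pexp s e = 1 + q%:R * y.
Proof.
have [|y yE] := @padic_divX (qexp p) (pexp s e - 1); last first.
  by exists y; rewrite qpowE -yE addrC subrK.
apply/pval_eq_sub.
apply: (rep_eq (rep_pexp (rep_refl _ s) (rep_absz _ e))).
rewrite /rep; apply/esym/congz; rewrite -qpowE.
by rewrite -[X in cong _ _ X](expr1n _ `|e (qexp p)|); apply: congX; apply: cong_unit.
Qed.

(** A nontrivial one-unit determines its exponents: by lifting the exponent,
    [t ^ d] is close to 1 only when [d] is close to 0. *)
Lemma pexp_inj s a b : s <> 0 -> pexp s a = pexp s b -> a = b.
Proof.
move=> s0 sab; suff : a - b = 0 by move/eqP; rewrite subr_eq0 => /eqP.
have {}sab : pexp s (a - b) = 1.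
  by rewrite pexpD sab -pexpD subrr pexp0.
move: (a - b) sab => d sd.
have [c sc] := padic_neq0 s0.
apply: padicP => n; rewrite pval0.
pose N := (qexp p + (c + n))%N.
have nN : (n <= N)%N by rewrite /N; lia.
have cN : (c <= N)%N by rewrite /N; lia.
have dN : rep n d `|d N|%N by rewrite pval_absz; apply: rep_le.
apply/(pval0_dvd dN); rewrite dvdzE /= -(dvd_geo p_pr _ _ (cong_unit (s N))).
apply: (dvdz_pX_mul (m := c)) (_ : ~~ (_ %| s N)%Z); last first.
  by apply/negP => /(pval0_dvd (rep_le s cN)).
have := rep_pexp (rep_refl N s) (rep_absz N d).
rewrite sd => r; have /esym/eqP := (rep_eqP (rep1 p N) r).1 erefl.
rewrite eqz_mod_dvd geo_sub1 addrC addKr addrC addKr /N expnD -qpowE PoszM.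
by rewrite -mulrA natz dvdz_mul2l ?qpowE.
Qed.

Lemma padic_nat_neq0 n : (0 < n)%N -> (n%:R : Zp) <> 0.
Proof.
move=> /(@geo_neq0 0); rewrite mulr0 addr0.
by rewrite (_ : geo 1 n = n%:R) // geo_one.
Qed.

Lemma pX_level n (a : Zp) : ((p ^ n)%:R * a) n = 0.
Proof.
by rewrite -{2}(addn0 n); apply/mulpX_eq0; rewrite -pval_mod modz1.
Qed.

Lemma pX_neq0 n : ((p ^ n)%:R : Zp) <> 0.
Proof. by apply: padic_nat_neq0; rewrite // expn_gt0 prime_gt0. Qed.

End Padic.

(** * The affine groups *)

Lemma In_mem (T : eqType) (x : T) s : List.In x s <-> x \in s.
Proof.
elim: s => [|y s IHs] /=; first by split.
rewrite inE; split=> [[->|/IHs ->]|/predU1P[->|/IHs]]; rewrite ?eqxx ?orbT //.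
  by left.
by right.
Qed.

Section PadicTopology.
Variables (p : nat) (p_pr : prime p).
Notation Zp := (padic_int p).

Lemma nbhs_padic (x : Zp) U : nbhs x U <-> exists n, forall y : Zp, y n = x n -> U y.
Proof.
rewrite nbhsE; split=> [[B [oB Bx] sBU]|[n nU]].
  by have [n nB] := oB x Bx; exists n => y /nB /sBU.
exists [set y : Zp | y n = x n] => //; split=> //.
have : padic_open [set y : Zp | y n = x n].
  by move=> y /= yx; exists n => z zy; rewrite zy.
exact.
Qed.

Variable m : nat.
Implicit Types (v w : 'rV[Zp]_m).

Lemma nbhs_row v U :
  nbhs v U <-> exists n, forall w, (forall i, w 0 i n = v 0 i n) -> U w.
Proof.
split=> [[P nP sPU]|[n nU]].
  have /choice[n nPn] i : exists n, forall y : Zp, y n = v 0 i n -> P 0 i y.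
    exact/nbhs_padic.
  exists (\max_i n i)%N => w wv; apply: sPU => j i; rewrite ord1.
  by apply/nPn/(padic_le _ (wv i))/leq_bigmax.
exists (fun _ i => [set y : Zp | y n = v 0 i n]) => [j i|w wv]; last first.
  by apply: nU => i; apply: wv.
by rewrite ord1; apply/nbhs_padic; exists n.
Qed.

Definition digit (i : 'I_m * nat) v : nat := absz (v 0 i.1 i.2).

Lemma digitP i n v w : digit (i, n) v = digit (i, n) w <-> v 0 i n = w 0 i n.
Proof.
rewrite /digit /=; split=> [vw|-> //].
by rewrite -(pval_absz p_pr (v 0 i)) vw pval_absz.
Qed.

Lemma nbhs_digit v U :
  nbhs v U <-> exists s, forall w, agree digit s v w -> U w.
Proof.
rewrite nbhs_row; split=> [[n nU]|[s sU]].
  exists [seq (i, n) | i <- enum 'I_m] => w vw; apply: nU => i.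
  by apply/digitP/vw/In_mem/map_f; rewrite mem_enum.
suff [n sn] : exists n, forall w, (forall i, w 0 i n = v 0 i n) -> agree digit s v w.
  by exists n => w /sn/sU.
elim: s {sU} => [|[i k] s [n IHs]]; first by exists 0%N => w _ i [].
exists (maxn k n) => w wv j /= [<-|js].
  by apply/digitP/(padic_le _ (wv i))/leq_maxl.
by apply: IHs js => l; apply: padic_le (wv l); apply: leq_maxr.
Qed.

Lemma row_compact : compact [set: 'rV[Zp]_m].
Proof.
apply: (coordinates_compact (b := fun i => (p ^ i.2)%N) nbhs_digit).
  by move=> i v; apply: pval_lt.
move=> a aP.
have co i : `[< coherent p (fun n => (a (i, n))%:Z) >].
  apply/asboolP => n; have [v va] := aP [:: (i, n); (i, n.+1)].
  rewrite -(va (i, n)) ?(va (i, n.+1)) /=; try by [left | right; left].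
  by rewrite -(va (i, n.+1)) /digit /= ?pval_absz //; [apply: pval_coherent | right; left].
exists (\row_i PadicInt (co i)) => -[i n].
by rewrite /digit /= mxE.
Qed.

Lemma row_hausdorff : hausdorff_space 'rV[Zp]_m.
Proof.
apply: (coordinates_hausdorff nbhs_digit) => v w vw.
by apply/rowP => i; apply: padicP => n; apply/digitP/vw.
Qed.

End PadicTopology.

Section AffineGroup.
Variables (p : nat) (p_pr : prime p) (m : nat).
Notation Zp := (padic_int p).
Notation q := (qpow p).
Variables (eps : 'I_m.+1 -> Zp) (eps0 : eps 0 = 1).

(** The proofs are arguments of the type so that the group structure, which
    depends on them, can be inferred from it. *)
Definition aff & prime p & eps 0 = 1 : Type := 'rV[Zp]_m.+1.

Notation G := (aff p_pr eps0).
Implicit Types (v w : G).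

Definition aff_char v i : Zp := pexp p_pr (v 0 0) (eps i).

Definition aff_mul v w : G := \row_i (v 0 i + aff_char v i * w 0 i).

Definition aff_inv v : G := \row_i (- (pexp p_pr (v 0 0) (- eps i) * v 0 i)).

Lemma aff_char0 v : aff_char v 0 = 1 + q%:R * v 0 0.
Proof. by rewrite /aff_char eps0 pexp1. Qed.

Lemma aff_charM v w i : aff_char (aff_mul v w) i = aff_char v i * aff_char w i.
Proof. by rewrite /aff_char mxE aff_char0 pexp_mul. Qed.

Fact aff_mulA : associative aff_mul.
Proof.
move=> u v w; apply/rowP => i; rewrite !mxE aff_charM.
by rewrite mulrDr addrA mulrA.
Qed.

Fact aff_mul1 : left_id (0 : G) aff_mul.
Proof.
by move=> v; apply/rowP => i; rewrite !mxE add0r /aff_char mxE pexp_zero mul1r.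
Qed.

Fact aff_mulr1 : right_id (0 : G) aff_mul.
Proof. by move=> v; apply/rowP => i; rewrite !mxE mulr0 addr0. Qed.

Fact aff_mulV : right_inverse (0 : G) aff_inv aff_mul.
Proof.
move=> v; apply/rowP => i; rewrite !mxE /aff_char mulrN mulrA -pexpD subrr.
by rewrite pexp0 mul1r subrr.
Qed.

Fact aff_mulVl : left_inverse (0 : G) aff_inv aff_mul.
Proof.
move=> v; rewrite -[LHS]aff_mulr1 -(aff_mulV (aff_inv v)) aff_mulA.
by rewrite -(aff_mulA _ v) aff_mulV aff_mulr1.
Qed.

HB.instance Definition _ := Topological.copy G 'rV[Zp]_m.+1.
HB.instance Definition _ := Choice.copy G 'rV[Zp]_m.+1.
HB.instance Definition _ := isGroup.Build G
  aff_mulA aff_mul1 aff_mulr1 aff_mulVl aff_mulV.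

Lemma aff_mulE v w i : (v * w)%g 0 i = v 0 i + aff_char v i * w 0 i.
Proof. by rewrite mxE. Qed.

Lemma aff_invE v i : (v^-1)%g 0 i = - (pexp p_pr (v 0 0) (- eps i) * v 0 i).
Proof. by rewrite mxE. Qed.

Lemma aff_oneE i : (1%g : G) 0 i = 0.
Proof. by rewrite mxE. Qed.

Fact aff_mul_continuous : continuous (fun vw : G * G => (vw.1 * vw.2)%g).
Proof.
move=> [v w] U /nbhs_row[n nU].
exists ([set v' : G | forall i, v' 0 i n = v 0 i n],
        [set w' : G | forall i, w' 0 i n = w 0 i n]) => /=.
  by split; apply/nbhs_row; exists n.
move=> [v' w'] /= [vv ww]; apply: nU => i; rewrite !aff_mulE.
by apply: pvalD_congr (vv i) _; apply: pvalM_congr (ww i); apply: pexp_congr.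
Qed.

Fact aff_inv_continuous : continuous (fun v : G => v^-1%g).
Proof.
move=> v U /nbhs_row[n nU]; apply/nbhs_row; exists n => w wv.
apply: nU => i; rewrite !aff_invE; apply: pvalN_congr.
by apply: pvalM_congr (wv i); apply: pexp_congr.
Qed.

HB.instance Definition _ := Group_isTopologicalGroup.Build G
  aff_mul_continuous aff_inv_continuous.

End AffineGroup.

(** * Uniformity *)

Section UniformGroup.
Variables (p : nat) (p_pr : prime p) (m : nat).
Notation Zp := (padic_int p).
Notation q := (qpow p).
Variables (eps : 'I_m.+1 -> Zp) (eps0 : eps 0 = 1).
Notation G := (aff p_pr eps0).
Implicit Types (v w : G) (i : 'I_m.+1).

(** Multiplication by a one-unit is invertible. *)
Lemma pexp_unit s e j (x : Zp) n : (pexp p_pr s e ^+ j * x) n = 0 -> x n = 0.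
Proof.
move=> x0; rewrite -[x]mul1r -(expr1n _ j) -(pexp0 p_pr s) -(addNr e) pexpD.
by rewrite exprMn -mulrA mulrC; apply: pvalM0.
Qed.

Lemma closed_row (S : set G) :
  (forall v, (forall n, exists2 w, S w & forall i, w 0 i n = v 0 i n) -> S v) ->
  closed S.
Proof.
move=> clS v cv; apply: clS => n.
have [|w [Sw wv]] := cv [set w : G | forall i, w 0 i n = v 0 i n].
  by apply/nbhs_row; exists n.
by exists w.
Qed.

Lemma aff_expE v n i : (v ^+ n)%g 0 i = geo (aff_char v i) n * v 0 i.
Proof.
elim: n => [|n IHn]; first by rewrite geo0 mul0r aff_oneE.
by rewrite expgS aff_mulE IHn geoS; ring.
Qed.

Lemma aff_char_unit v i : exists y, aff_char v i = 1 + q%:R * y.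
Proof. exact: pexp_one_unit. Qed.

Lemma aff_char_trans v i : v 0 0 = 0 -> aff_char v i = 1.
Proof. by rewrite /aff_char => ->; rewrite pexp_zero. Qed.

Definition congruence_subgroup n : set G := [set v : G | forall i, v 0 i n = 0].

Lemma congruence_subgroupP n : subgroup (congruence_subgroup n).
Proof.
split=> [i|v w v0 w0 i]; first by rewrite aff_oneE pval0.
rewrite aff_mulE; apply: pvalD0 (v0 i) _; rewrite mulrC; apply: pvalM0.
by rewrite aff_invE (pvalN_congr (x' := 0)) ?oppr0 ?pval0 // mulrC; apply: pvalM0.
Qed.

Lemma congruence_subgroup_open n : open (congruence_subgroup n).
Proof.
rewrite openE => v v0; apply/nbhs_row; exists n => w wv i.
by rewrite wv; apply: v0.
Qed.

Lemma nbhs1_congruence (U : set G) :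
  nbhs 1%g U -> exists n, congruence_subgroup n `<=` U.
Proof.
move=> /nbhs_row[n nU]; exists n => v v0; apply: nU => i.
by rewrite aff_oneE pval0; apply: v0.
Qed.

Lemma aff_expX_congruence v n : congruence_subgroup n (v ^+ (p ^ n))%g.
Proof.
move=> i; rewrite aff_expE; apply: pvalM0.
by have [y ->] := aff_char_unit v i; apply/(geo_level p_pr).
Qed.

Lemma aff_pro_p : pro_p p G.
Proof.
apply: pro_p_criterion => //.
- exact: row_compact.
- exact: row_hausdorff.
- move=> U /nbhs1_congruence[n nU]; exists (congruence_subgroup n); split=> //.
    exact: congruence_subgroupP.
  exact: congruence_subgroup_open.
move=> N v [sN nN] oN; have [|n nN1] := @nbhs1_congruence N.
  by apply: open_nbhs_nbhs; split=> //; apply: sN.1.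
by exists n; apply/nN1/aff_expX_congruence.
Qed.

Lemma aff_commgE v w i :
  aff_char v i * aff_char w i * [~ v, w]%g 0 i =
  (1 - aff_char w i) * v 0 i - (1 - aff_char v i) * w 0 i.
Proof.
have := congr1 (fun u : G => u 0 i) (commgC v w); move: [~ v, w]%g => c.
rewrite !aff_mulE aff_charM => E.
transitivity ((v 0 i + aff_char v i * w 0 i) - (w 0 i + aff_char w i * v 0 i)).
  by rewrite E; ring.
by ring.
Qed.

Lemma aff_comm00 v w : [~ v, w]%g 0 0 = 0.
Proof.
apply: padicP => n; rewrite pval0; apply: (@pexp_unit (w 0 0) (eps 0) 1).
apply: (@pexp_unit (v 0 0) (eps 0) 1); rewrite !expr1 mulrA aff_commgE.
rewrite !aff_char0 (_ : _ - _ = 0) ?pval0 //; ring.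
Qed.

(** It contains the commutators, and its elements are [q]-th powers of
    translations: hence the group is both powerful and metabelian. *)
Definition q_translations : set G :=
  [set v : G | v 0 0 = 0 /\ forall i, v 0 i (qexp p) = 0].

Lemma char_sub1 v i : (1 - aff_char v i) (qexp p) = 0.
Proof.
have [y ->] := aff_char_unit v i; rewrite opprD addrA subrr sub0r -mulrN.
by rewrite qpowE -{2}(addn0 (qexp p)); apply/mulpX_eq0 => //; rewrite -pval_mod modz1.
Qed.

Lemma commg_q_translations v w : q_translations [~ v, w]%g.
Proof.
split=> [|i]; first exact: aff_comm00.
apply: (@pexp_unit (w 0 0) (eps i) 1); apply: (@pexp_unit (v 0 0) (eps i) 1).
rewrite !expr1 mulrA aff_commgE; apply: pvalD0; first exact: pvalM0 (char_sub1 _ _).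
by rewrite -mulNr; apply: pvalM0; rewrite (pvalN_congr (x' := 0)) ?oppr0 ?pval0 // char_sub1.
Qed.

Lemma translation_mulE v w : v 0 0 = 0 -> (v * w)%g = v + w :> 'rV_m.+1.
Proof. by move=> v0; apply/rowP => i; rewrite aff_mulE aff_char_trans // mul1r mxE. Qed.

Lemma translation_expE v n i : v 0 0 = 0 -> (v ^+ n)%g 0 i = n%:R * v 0 i.
Proof. by move=> v0; rewrite aff_expE aff_char_trans // geo_one. Qed.

Lemma q_translation_root v : q_translations v ->
  exists u : G, u 0 0 = 0 /\ v = (u ^+ q)%g.
Proof.
move=> [v0 vq].
have /choice[u uE] i : exists y : Zp, v 0 i = q%:R * y.
  by rewrite qpowE; apply: padic_divX.
pose u' : G := \row_i u i.
have u0 : u' 0 0 = 0.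
  have := uE 0; rewrite v0 mxE => /esym/padic_mulf_eq0[] // /padic_nat_neq0[] //.
  by rewrite qpowE expn_gt0 prime_gt0.
by exists u'; split=> //; apply/rowP => i; rewrite translation_expE // mxE.
Qed.

Lemma q_translations_subgroup : subgroup q_translations.
Proof.
split; first by split=> [|i]; rewrite aff_oneE ?pval0.
move=> v w [v0 vq] [w0 wq]; split=> [|i]; rewrite translation_mulE // !mxE.
  by rewrite v0 w0 mulr0 oppr0 addr0.
apply: pvalD0 (vq i) _; rewrite w0 pexp_zero mul1r.
by rewrite (pvalN_congr (x' := 0)) ?oppr0 ?pval0.
Qed.

Lemma q_translations_closed : closed q_translations.
Proof.
apply: closed_row => v vD; split=> [|i].
  by apply: padicP => n; have [w [w0 _] <-] := vD n; rewrite w0.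
by have [w [_ wq] <-] := vD (qexp p); apply: wq.
Qed.

Lemma closed_derived_sub : closed_derived G `<=` q_translations.
Proof.
apply: closed_gen_sub; first exact: q_translations_subgroup.
  exact: q_translations_closed.
by move=> _ [[v w] _ <-]; apply: commg_q_translations.
Qed.

Lemma aff_powerful : powerful p G.
Proof.
split; first exact: aff_pro_p.
move=> v /closed_derived_sub/q_translation_root[u [_ ->]].
by apply: sub_closed_gen; exists u.
Qed.

Lemma translation_commute v w : v 0 0 = 0 -> w 0 0 = 0 -> commute v w.
Proof. by move=> v0 w0; rewrite /commute !translation_mulE // addrC. Qed.

Lemma aff_metabelian : metabelian G.
Proof.
move=> v w /closed_derived_sub[v0 _] /closed_derived_sub[w0 _].
exact: translation_commute.
Qed.

Lemma aff_torsion_free : torsion_free G.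
Proof.
move=> v n n0 vn1; apply/rowP => i; rewrite aff_oneE.
have := congr1 (fun u : G => u 0 i) vn1; rewrite aff_expE aff_oneE.
by have [y ->] := aff_char_unit v i; case/(padic_mulf_eq0 p_pr) => // /geo_neq0[].
Qed.

Definition gen i : G := delta_mx 0 i.

Lemma genE i j : gen i 0 j = (j == i)%:R.
Proof. by rewrite mxE. Qed.

(** The powers of [1 + q] are dense among the one-units: by lifting the exponent
    the first [p ^ n] of them take distinct values, hence all values, modulo
    [q * p ^ n]. *)
Lemma geo_dense (s : Zp) n : exists j, geo (1 + q%:R * 1 : Zp) j n = s n.
Proof.
pose f (j : 'I_(p ^ n)) := Ordinal (pval_lt p_pr (geo (1 + q%:R * 1 : Zp) j) n).
have f_inj : injective f.
  suff le_inj (j k : 'I_(p ^ n)) : (j <= k)%N -> f j = f k -> j = k.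
    by move=> j k; case: (leqP j k) => [|/ltnW] jk; [|move=> /esym]; move/le_inj->.
  move=> jk [] /(congr1 Posz); rewrite !pval_absz // -(subnKC jk) geoD => /esym.
  move=> /pval_eq_sub; rewrite addrC addKr -(pexp1 p_pr) => /pexp_unit.
  rewrite pexp1 => /(geo_level p_pr); have := ltn_ord k.
  have [kj _ _|kj ltk] := posnP (k - j)%N; first by apply: val_inj => /=; lia.
  by move=> /(dvdn_leq kj); lia.
have [g fK gK] := injF_bij f_inj.
exists (g (Ordinal (pval_lt p_pr s n))).
rewrite -[LHS](pval_absz p_pr) -[RHS](pval_absz p_pr).
exact: (congr1 (fun j : 'I_(p ^ n) => Posz j) (gK (Ordinal (pval_lt p_pr s n)))).
Qed.

Lemma gen_pow0 j i : (gen 0 ^+ j)%g 0 i = (i == 0)%:R * geo (1 + q%:R * 1) j.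
Proof.
rewrite aff_expE genE; case: eqP => [->|_]; last by rewrite mulr0 mul0r.
by rewrite aff_char0 genE eqxx !mulr1 mul1r.
Qed.

Lemma gens_generate : closed_gen (range gen) = [set: G].
Proof.
apply/seteqP; split=> // v _ U /nbhs_row[n nU].
set S := smallest _ _; have sS : subgroup S by apply: smallest_subgroup.
have Sg i : S (gen i) by apply: sub_gen_smallest; exists i.
(* Modulo [p ^ n], [v] is a translation times a power of the first generator. *)
have [j jE] := geo_dense (v 0 0) n.
pose t : G := \sum_(i | i != 0) (gen i ^+ absz (v 0%R i n) : 'rV[Zp]_m.+1)%g.
have [St t0] : S t /\ t 0 0 = 0.
  apply: (big_ind (fun x : G => S x /\ x 0 0 = 0)).
  - by split; [apply: sS.1 | rewrite mxE].
  - move=> x y [Sx x0] [Sy y0]; split; last by rewrite mxE x0 y0 addr0.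
    by rewrite -(translation_mulE y x0); exact: subgroupM sS Sx Sy.
  move=> i i0; split; first exact: (subgroupX _ sS (Sg i)).
  by rewrite aff_expE genE eq_sym (negPf i0) mulr0.
exists (t * gen 0 ^+ j)%g; split.
  exact: (subgroupM sS St (subgroupX _ sS (Sg 0))).
apply: nU => i; rewrite aff_mulE aff_char_trans // mul1r gen_pow0.
have [->|i0] := eqVneq i 0; first by rewrite t0 add0r mul1r.
rewrite mul0r addr0 summxE (bigD1 i) // big1 => [|k /andP[k0 ki]]; last first.
  by rewrite aff_expE genE eq_sym (negPf ki) mulr0.
rewrite Monoid.mulm1 translation_expE ?genE ?eqxx 1?eq_sym ?(negPf i0) // mulr1.
by rewrite (rep_nat p n (absz (v 0 i n))) natz pval_absz // pval_mod.
Qed.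

Lemma aff_gen_by : gen_by G m.+1.
Proof. by exists gen; apply: gens_generate. Qed.

Lemma aff_uniform : uniform_pro_p p G.
Proof.
split; [exact: aff_powerful | by exists m.+1; apply: aff_gen_by |].
exact: aff_torsion_free.
Qed.

End UniformGroup.

(** * Analyticity *)

Section Series.
Variables (p : nat) (p_pr : prime p) (r : nat).
Notation Zp := (padic_int p).
Notation expo := {ffun 'I_r -> nat}.
Implicit Types (f g : 'rV[Zp]_r -> Zp) (c : expo -> Zp) (z : 'rV[Zp]_r) (a : expo).

Definition monomial a z : Zp := \prod_(j < r) z 0 j ^+ a j.

(** Convergence is expressed by congruences with finite sums, uniform in [z].
    This implies unconditional convergence, and makes stability under sums and
    under multiplication by a variable immediate. *)
Definition series_with c f := forall n, exists A : {fset expo},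
  (forall a, a \notin A -> c a n = 0) /\
  forall z, (\sum_(a <- A) c a * monomial a z) n = f z n.

Definition is_series f := exists c, series_with c f.

Lemma series_sub n c (A B : {fset expo}) z :
  (forall a, a \notin A -> c a n = 0) -> (A `<=` B)%fset ->
  (\sum_(a <- B) c a * monomial a z) n = (\sum_(a <- A) c a * monomial a z) n.
Proof.
move=> cA AB.
rewrite !(rep_sum _ _ (fun a => rep_refl n (c a * monomial a z))).
rewrite -(big_fset_incl _ AB) // => a _ /cA ca.
exact: pvalM0.
Qed.

Lemma is_series_power f : is_series f ->
  exists c, forall z, power_series_at c z (f z).
Proof.
case=> c cf; exists c => z U /nbhs_padic[n nU]; have [A [cA Af]] := cf n.
exists A => // B /= AB; apply: nU.
by rewrite -Af -(series_sub z cA AB).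
Qed.

Lemma is_series_ext f g : (forall z, f z = g z) -> is_series f -> is_series g.
Proof. by move=> /funext ->. Qed.

Lemma is_series_cst (y : Zp) : is_series (fun=> y).
Proof.
exists (fun a => if a == [ffun=> 0%N] then y else 0) => n.
exists [fset ([ffun=> 0%N] : expo)]%fset; split=> [a|z].
  by rewrite inE => /negPf ->; rewrite pval0.
rewrite big_seq_fset1 eqxx /monomial big1 ?mulr1 // => j _.
by rewrite ffunE expr0.
Qed.

Lemma is_seriesD f g : is_series f -> is_series g -> is_series (fun z => f z + g z).
Proof.
move=> [c cf] [d dg]; exists (fun a => c a + d a) => n.
have [[A [cA Af]] [B [dB Bg]]] := (cf n, dg n); exists (A `|` B)%fset; split=> [a|z].
  rewrite inE negb_or => /andP[aA aB].
  by apply: pvalD0; [apply: cA | apply: dB].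
rewrite (eq_bigr (fun a => c a * monomial a z + d a * monomial a z)); last first.
  by move=> a _; rewrite mulrDl.
rewrite big_split; apply: pvalD_congr.
  by rewrite -Af; apply: series_sub => //; apply: fsubsetUl.
by rewrite -Bg; apply: series_sub => //; apply: fsubsetUr.
Qed.

Lemma is_seriesZ (y : Zp) f : is_series f -> is_series (fun z => y * f z).
Proof.
move=> [c cf]; exists (fun a => y * c a) => n; have [A [cA Af]] := cf n.
exists A; split=> [a /cA ca|z]; first by rewrite mulrC; apply: pvalM0.
rewrite (eq_bigr (fun a => y * (c a * monomial a z))); last first.
  by move=> a _; rewrite mulrA.
by rewrite -mulr_sumr; apply: pvalM_congr.
Qed.

Definition incr j a : expo := [ffun i => (a i + (i == j))%N].
Definition decr j a : expo := [ffun i => (a i - (i == j))%N].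

Lemma incrK j : cancel (incr j) (decr j).
Proof. by move=> a; apply/ffunP => i; rewrite !ffunE addnK. Qed.

Lemma decrK j a : (0 < a j)%N -> incr j (decr j a) = a.
Proof.
move=> aj; apply/ffunP => i; rewrite !ffunE.
by case: eqP => [->|_]; rewrite ?subnK // subn0 addn0.
Qed.

Lemma monomial_incr j a z : monomial (incr j a) z = z 0 j * monomial a z.
Proof.
rewrite /monomial (bigD1 j) //= [in RHS](bigD1 j) //= mulrA; congr (_ * _).
  by rewrite ffunE eqxx addn1 exprS.
by apply: eq_bigr => i /negPf ij; rewrite ffunE ij addn0.
Qed.

Lemma is_series_mulX j f : is_series f -> is_series (fun z => z 0 j * f z).
Proof.
move=> [c cf]; exists (fun a => if (0 < a j)%N then c (decr j a) else 0) => n.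
have [A [cA Af]] := cf n; exists [fset incr j a | a in A]%fset; split=> [a aA|z].
  case: ifP => [aj|_]; last by rewrite pval0.
  by apply: cA; apply: contra aA => dA; rewrite -(decrK aj) in_imfset.
rewrite big_imfset; last by move=> a b _ _; apply: (can_inj (incrK j)).
rewrite (_ : \sum_(_ <- _) _ = z 0 j * \sum_(a <- A) c a * monomial a z).
  exact: pvalM_congr.
rewrite mulr_sumr; apply: eq_bigr => a _.
by rewrite incrK ffunE eqxx addn1 ltn0Sn monomial_incr; ring.
Qed.

Lemma is_series_var j : is_series (fun z => z 0 j).
Proof.
apply: is_series_ext (is_series_mulX j (is_series_cst 1)) => z.
by rewrite mulr1.
Qed.

Definition single j (k : nat) : expo := [ffun i => (k * (i == j))%N].

Lemma single_inj j : injective (single j).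
Proof.
by move=> k l /ffunP/(_ j); rewrite !ffunE eqxx !muln1.
Qed.

Lemma monomial_single j k z : monomial (single j k) z = z 0 j ^+ k.
Proof.
rewrite /monomial (bigD1 j) //= big1 ?mulr1 => [|i /negPf ij].
  by rewrite ffunE eqxx muln1.
by rewrite ffunE ij muln0 expr0.
Qed.

(** For a fixed exponent, the coefficients of the [P n] form a compatible
    sequence, that is a [p]-adic coefficient; modulo [p ^ n] it vanishes unless
    the exponent occurs in [P n]. *)
Lemma is_series_poly j (P : nat -> {poly int}) (f : Zp -> Zp) :
  (forall n, cong (p ^ n) (P n.+1) (P n)) ->
  (forall n x, rep n (f x) (P n).[x n]) ->
  is_series (fun z => f (z 0 j)).
Proof.
move=> cP fP.
have cc k n : ((P n.+1)`_k = (P n)`_k %[mod (p ^ n)%N])%Z.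
  have [w ->] := cP n; rewrite coefD mulr_natl coefMn.
  by apply/congz; exists w`_k; rewrite mulr_natl.
exists (fun a => if a == single j (a j) then mk_padic (cc (a j)) else 0) => n.
exists (seq_fset tt [seq single j k | k <- iota 0 (size (P n))]); split=> [a|z].
  rewrite seq_fsetE; case: eqP => [->|]; last by rewrite pval0.
  rewrite (mem_map (@single_inj j)) mem_iota /= add0n -leqNgt ffunE eqxx muln1 => sa.
  by rewrite nth_default ?mod0z.
have us : uniq [seq single j k | k <- iota 0 (size (P n))].
  by rewrite map_inj_uniq ?iota_uniq //; apply: single_inj.
rewrite (perm_big _ (seq_fset_perm _ _)) undup_id //.
rewrite big_map (fP n) horner_coef -(big_mkord xpredT (fun k => (P n)`_k * z 0 j n ^+ k)).
rewrite /index_iota subn0 -/(rep n _ _); apply: rep_sum => k.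
have kk : single j k j = k by rewrite ffunE eqxx muln1.
rewrite kk eqxx monomial_single; apply: repM; first by [].
by apply: repX; apply: rep_refl.
Qed.

(** Modulo [p ^ n] the function is a polynomial, and a change of the exponent by
    a multiple of [p ^ n] does not affect its coefficients modulo [p ^ n]. *)
Lemma is_series_pexp (x e : Zp) j : is_series (fun z => pexp p_pr (x + z 0 j) e).
Proof.
pose P n : {poly int} := (1 + (qpow p)%:R * ((x n)%:P + 'X)) ^+ absz (e n).
apply: (@is_series_poly j P (fun y => pexp p_pr (x + y) e)) => n.
  rewrite /P; apply: cong_exp.
  - by apply: cong_dvd (dvdp_q p) _; eexists.
  - apply: congD; first exact: cong_refl.
    apply: congM; first exact: cong_refl.
    apply: congD; last exact: cong_refl.
    have /congz[w ->] := pval_compatible x n; exists w%:P.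
    by rewrite polyCD polyCM -polyC_natr.
  - apply/eqP; rewrite -(eqz_nat) /= -!modz_nat !pval_absz //; apply/eqP.
    exact: pval_compatible.
move=> y; have := rep_pexp p_pr (repD (rep_refl n x) (rep_refl n y)) (rep_absz p_pr n e).
by rewrite /P -polyC_natr !hornerE.
Qed.

End Series.

Section Analytic.
Variables (p : nat) (p_pr : prime p) (m : nat).
Notation Zp := (padic_int p).
Variables (eps : 'I_m.+1 -> Zp) (eps0 : eps 0 = 1).
Notation G := (aff p_pr eps0).

Fact aff_chart_continuous (v : G) :
  [set: G] v -> {for v, continuous (id : G -> 'rV[Zp]_m.+1)}.
Proof. by move=> _ U. Qed.

Fact aff_chart_open (U : set G) : open U -> U `<=` [set: G] ->
  open ((id : G -> 'rV[Zp]_m.+1) @` U).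
Proof. by move=> oU _; rewrite image_id. Qed.

Fact aff_chart_inj (v w : G) : [set: G] v -> [set: G] w ->
  (v : 'rV[Zp]_m.+1) = w -> v = w.
Proof. by []. Qed.

Definition aff_chart : chart p G m.+1 :=
  Chart (@openT G) aff_chart_continuous aff_chart_inj aff_chart_open.

(** For maps given by integral power series on the whole of [Z_p ^ r], the case
    [n = k = 0] of the definition suffices. *)
Lemma analytic_atI (X Y : Type) (r s : nat) (phi : X -> 'rV[Zp]_r)
    (psi : Y -> 'rV[Zp]_s) (U : set X) (V : set Y) (f : X -> Y) (x0 : X)
    (phi' : 'rV[Zp]_r -> X) :
  (forall z, U (phi' z)) -> (forall y, V y) ->
  (forall z, phi (phi' z) = phi x0 + z) ->
  (forall i, is_series (fun z => psi (f (phi' z)) 0 i)) ->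
  analytic_at U phi V psi f x0.
Proof.
move=> Uphi VT phiK serf.
have /choice[c cP] i := is_series_power (serf i).
exists 0%N, 0%N, c => z; exists (phi' z); split=> //.
  by rewrite phiK expn0 scale1r.
by move=> i; rewrite expn0 mul1r.
Qed.

Lemma aff_analytic : analytic_group_dim p G m.+1.
Proof.
exists [set aff_chart]; split.
- split=> [v|c d v -> -> _ _]; first by exists aff_chart.
  apply: (analytic_atI (phi' := fun z => (v : 'rV_m.+1) + z)) => //= i.
  apply: is_series_ext (is_seriesD (is_series_cst _ (v 0 i)) (is_series_var _ i)).
  by move=> z; rewrite mxE.
- move=> c d e v w -> -> -> _ _ _.
  apply: (analytic_atI (phi' := fun z : 'rV[Zp]_(m.+1 + m.+1) =>
    ((v : 'rV_m.+1) + lsubmx z, (w : 'rV_m.+1) + rsubmx z) : G * G)) => //= [z|i].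
    by rewrite -{3}(hsubmxK z) add_row_mx.
  have va := is_seriesD (is_series_cst _ (v 0 i)) (is_series_var _ (lshift m.+1 i)).
  have va0 := is_series_pexp p_pr (v 0 0) (eps i) (lshift m.+1 (0 : 'I_m.+1)).
  have vb := is_seriesZ (w 0 i) va0.
  have vc := is_series_mulX (rshift m.+1 i) va0.
  apply: is_series_ext (is_seriesD va (is_seriesD vb vc)) => z.
  rewrite aff_mulE /aff_char !mxE.
  by rewrite mulrDr [in RHS]mulrC; congr (_ + (_ + _)); rewrite mulrC.
- move=> c d v -> -> _ _.
  apply: (analytic_atI (phi' := fun z => (v : 'rV_m.+1) + z)) => //= i.
  have va0 := is_series_pexp p_pr (v 0 0) (- eps i) (0 : 'I_m.+1).
  have vb := is_seriesZ (v 0 i) va0; have vc := is_series_mulX i va0.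
  apply: is_series_ext (is_seriesZ (-1) (is_seriesD vb vc)) => z.
  by rewrite aff_invE !mxE; ring.
Qed.

End Analytic.

(** * Commensurability *)

Section HomOnSubgroup.
Local Open Scope group_scope.
Variables (G L : topGroupType) (H : set G) (f : G -> L).
Hypotheses (sH : subgroup H)
  (fM : forall x y, H x -> H y -> f (x * y) = f x * f y).

Lemma hom_on1 : f 1 = 1.
Proof.
have H1 := subgroup1 sH; apply: (@mulgI _ (f 1)).
by rewrite -fM // !mulg1.
Qed.

Lemma hom_onV x : H x -> f x^-1 = (f x)^-1.
Proof.
move=> Hx; apply: (@mulgI _ (f x)); rewrite -fM ?mulgV ?hom_on1 //.
exact: subgroupV.
Qed.

Lemma hom_onX x n : H x -> f (x ^+ n) = f x ^+ n.
Proof.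
move=> Hx; elim: n => [|n IHn]; first exact: hom_on1.
by rewrite !expgS fM ?IHn //; apply: subgroupX.
Qed.

Lemma subgroup_commg x y : H x -> H y -> H [~ x, y].
Proof.
move=> Hx Hy; rewrite commgEl conjgE.
by do ?[apply: subgroupM | apply: subgroupV].
Qed.

Lemma hom_on_commg x y : H x -> H y -> f [~ x, y] = [~ f x, f y].
Proof.
move=> Hx Hy; have [Hx' Hy'] := (subgroupV sH Hx, subgroupV sH Hy).
by rewrite !commgEl !conjgE !fM ?hom_onV //; do ?apply: subgroupM.
Qed.

End HomOnSubgroup.

Section PexpPexp.
Variables (p : nat) (p_pr : prime p).
Implicit Types s a b : padic_int p.

Lemma pexp_pexp s s' a b :
  pexp p_pr s' 1 = pexp p_pr s a -> pexp p_pr s' b = pexp p_pr s (a * b).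
Proof.
move=> s'a; apply: padicP => n; have [rs rs'] := (rep_refl n s, rep_refl n s').
have [ra rb] := (rep_absz p_pr n a, rep_absz p_pr n b).
have E1 := rep_pexp p_pr rs' (rep1 p n); have E2 := rep_pexp p_pr rs ra.
rewrite -s'a in E2; rewrite expr1 in E1.
apply: (rep_eq (rep_pexp p_pr rs' rb)).
rewrite /rep (rep_pexp p_pr rs (repM ra rb)) exprM; apply/congz/congX/congz.
by rewrite -E1 E2.
Qed.

End PexpPexp.

Section Commensurability.
Variables (p : nat) (p_pr : prime p) (m : nat).
Notation Zp := (padic_int p).
Variables (eps eps' : 'I_m.+2 -> Zp) (eps0 : eps 0 = 1) (eps0' : eps' 0 = 1).
Notation G := (aff p_pr eps0).
Notation L := (aff p_pr eps0').

Definition scaled_gen (e : 'I_m.+2 -> Zp) (e0 : e 0 = 1) (a : Zp) i : aff p_pr e0 :=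
  a *: delta_mx 0 i.

Lemma scaled_genE e (e0 : e 0 = 1) a i j :
  (scaled_gen e0 a i : 'rV_m.+2) 0 j = a * (j == i)%:R.
Proof. by rewrite !mxE. Qed.

Lemma open_subgroup_congruence e (e0 : e 0 = 1) (H : set (aff p_pr e0)) :
  subgroup H -> open H -> exists n, @congruence_subgroup p p_pr m.+1 _ e0 n `<=` H.
Proof.
move=> sH oH; apply: nbhs1_congruence; apply: open_nbhs_nbhs.
by split=> //; apply: subgroup1.
Qed.

Lemma congruence_scaled_gen e (e0 : e 0 = 1) n (a : Zp) i : a n = 0 ->
  congruence_subgroup n (scaled_gen e0 a i).
Proof. by move=> a0 j; rewrite scaled_genE; apply: pvalM0. Qed.

Variables (H : set G) (K : set L) (f : G -> L) (g : L -> G).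
Hypotheses (sH : subgroup H) (oH : open H) (sK : subgroup K) (oK : open K).
Hypotheses (fK : forall x, H x -> K (f x) /\ g (f x) = x)
  (gK : forall y, K y -> H (g y) /\ f (g y) = y)
  (fM : forall x y, H x -> H y -> f (x * y)%g = (f x * f y)%g).
Hypothesis eps'1 : eps' 1 = 1.

(** The translations in an open subgroup form the centralizer of its
    commutators; so they are preserved by isomorphisms. *)
Lemma iso_translation v : H v -> v 0 0 = 0 -> f v 0 0 = 0.
Proof.
move=> Hv v0; have [n nK] := open_subgroup_congruence sK oK.
have pn0 : ((p ^ n)%:R : Zp) n = 0 by rewrite -[_%:R]mulr1 pX_level.
(* A nontrivial commutator in [K], with which [f v] commutes. *)
pose k := scaled_gen eps0' (p ^ n)%:R 0; pose e := scaled_gen eps0' (p ^ n)%:R 1.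
have Kk : K k by apply/nK/congruence_scaled_gen.
have Ke : K e by apply/nK/congruence_scaled_gen.
have e0 : e 0 0 = 0 by rewrite scaled_genE mulr0.
have [[Hgk fgk] [Hge fge]] := (gK Kk, gK Ke).
have := hom_on_commg sH fM Hgk Hge; rewrite fgk fge => cE.
set d := [~ g k, g e]%g in cE.
have Hd : H d by apply: subgroup_commg.
have : (f v * f d = f d * f v)%g.
  by rewrite -!fM // (translation_commute v0 (aff_comm00 _ _)).
rewrite cE; have c0 := aff_comm00 k e.
have := aff_commgE k e 1; rewrite (aff_char_trans _ e0) subrr mul0r sub0r mulr1.
move: [~ k, e]%g c0 => c c0 cE1.
move=> /(congr1 (fun u : L => u 0 1)); rewrite !aff_mulE (aff_char_trans _ c0) mul1r.
rewrite addrC => /addIr /eqP; rewrite -subr_eq0 -{2}[c 0 1]mul1r -mulrBl => /eqP.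
case/(padic_mulf_eq0 p_pr).
  rewrite /aff_char eps'1 pexp1 addrC addKr => /(padic_mulf_eq0 p_pr)[] //.
  by move/padic_nat_neq0 => []; rewrite // qpowE expn_gt0 prime_gt0.
move=> c1; move: cE1; rewrite c1 mulr0 => /esym/eqP; rewrite oppr_eq0 => /eqP.
rewrite /aff_char eps'1 pexp1 !scaled_genE eqxx !mulr1.
case/(padic_mulf_eq0 p_pr) => [/eqP|/pX_neq0 //].
rewrite opprD addrA subrr sub0r oppr_eq0 => /eqP /(padic_mulf_eq0 p_pr)[].
  by move/padic_nat_neq0 => []; rewrite // qpowE expn_gt0 prime_gt0.
by move/pX_neq0.
Qed.

(** Additivity alone forces linearity over the [p]-adic integers: if
    [a = a_N + p ^ N * b], then [f (a v)] and [a_N * f v] differ by a multiple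
    of [p ^ N]. *)
Lemma iso_linear n (a : Zp) i j : @congruence_subgroup p p_pr m.+1 _ eps0 n `<=` H ->
  i != 0 ->
  f (scaled_gen eps0 (a * (p ^ n)%:R) i) 0 j =
  a * f (scaled_gen eps0 (p ^ n)%:R i) 0 j.
Proof.
move=> nH i0; pose v (b : Zp) := scaled_gen eps0 (b * (p ^ n)%:R) i.
have v0 b : v b 0 0 = 0 by rewrite scaled_genE eq_sym (negPf i0) mulr0.
have Hv b : H (v b) by apply/nH/congruence_scaled_gen; rewrite mulrC pX_level.
have fv0 b : f (v b) 0 0 = 0 by apply: iso_translation.
have -> : scaled_gen eps0 (p ^ n)%:R i = v 1 by rewrite /v mul1r.
rewrite -/(v a); apply: padicP => N.
have [b bE] : exists b, a - (absz (a N))%:R = (p ^ N)%:R * b.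
  apply: padic_divX => //; apply/pval_eq_sub.
  by rewrite [RHS](rep_nat p N (absz (a N))) natz pval_absz // pval_mod.
have aE : a = (absz (a N))%:R + (p ^ N)%:R * b by rewrite -bE addrC subrK.
have -> : v a = (v 1%R ^+ absz (a N) * v b ^+ (p ^ N))%g.
  apply/rowP => k; rewrite translation_mulE; last first.
    by rewrite translation_expE // v0 mulr0.
  rewrite [RHS]mxE !translation_expE //.
  rewrite !scaled_genE {1}aE; ring.
rewrite fM; try exact: subgroupX.
rewrite !(hom_onX sH fM) // aff_mulE aff_char_trans; last first.
  by rewrite translation_expE // fv0 mulr0.
rewrite mul1r !translation_expE // {2}aE mulrDl.
apply: pvalD_congr => //.
by rewrite pX_level // -mulrA pX_level.
Qed.

(** Apply [f] to the conjugate of an eigenvector [v] by [h]: any nonzero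
    coordinate of [f v] exhibits the eigenvalue of [h] as one of [f h]. *)
Lemma iso_eigenvalue n i : @congruence_subgroup p p_pr m.+1 _ eps0 n `<=` H -> i != 0 ->
  exists2 j, j != 0 & pexp p_pr (p ^ n)%:R (eps i) =
    pexp p_pr (f (scaled_gen eps0 (p ^ n)%:R 0) 0 0) (eps' j).
Proof.
move=> nH i0.
have pn0 : ((p ^ n)%:R : Zp) n = 0 by rewrite -[_%:R]mulr1 pX_level.
set h := scaled_gen eps0 _ 0; pose v := scaled_gen eps0 (p ^ n)%:R i.
have Hh : H h by apply/nH/congruence_scaled_gen.
have Hv : H v by apply/nH/congruence_scaled_gen.
have v0 : v 0 0 = 0 by rewrite scaled_genE eq_sym (negPf i0) mulr0.
pose y := scaled_gen eps0 (aff_char h i * (p ^ n)%:R) i.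
have y0 : y 0 0 = 0 by rewrite scaled_genE eq_sym (negPf i0) mulr0.
have Hy : H y by apply/nH/congruence_scaled_gen; rewrite mulrC pX_level.
have hv : (h * v = y * h)%g.
  apply/rowP => k; rewrite !aff_mulE (aff_char_trans _ y0) mul1r addrC.
  by congr (_ + _); rewrite !scaled_genE; case: eqP => [->|_]; rewrite ?mulr0 // mulrA.
have [j fvj] : exists j, f v 0 j <> 0.
  apply: contrapT => fv0; apply: (@pX_neq0 p p_pr n).
  have fv1 : f v = 1%g.
    apply/rowP => j; rewrite aff_oneE; apply: contrapT => fvj.
    by apply: fv0; exists j.
  have := (fK Hv).2; rewrite fv1 -(hom_on1 sH fM) (fK (subgroup1 sH)).2.
  move=> /(congr1 (fun u : G => u 0 i)); rewrite aff_oneE scaled_genE eqxx mulr1.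
  by move=> <-.
have fv0 := iso_translation Hv v0; have fy0 := iso_translation Hy y0.
have j0 : j != 0 by apply/eqP => j0; apply: fvj; rewrite j0.
exists j => //; have := congr1 f hv; rewrite !fM //.
move=> /(congr1 (fun u : L => u 0 j)); rewrite !aff_mulE (aff_char_trans _ fy0).
rewrite mul1r (iso_linear _ _ nH i0) addrC => /addIr /esym/eqP.
rewrite -subr_eq0 -mulrBl => /eqP/(padic_mulf_eq0 p_pr)[|/fvj //].
by move/eqP; rewrite subr_eq0 /aff_char {1}/h scaled_genE eqxx mulr1 => /eqP.
Qed.

End Commensurability.

Section TwoExponents.
Variables (p : nat) (p_pr : prime p) (k : nat).
Notation Zp := (padic_int p).

(** With these exponents the eigenvalues of [t = 1 + q s] on translations are
    [t], once, and [t ^ lam]. *)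
Definition fam_eps (lam : Zp) (i : 'I_k.+3) : Zp := if (i < 2)%N then 1 else lam.

Fact fam_eps0 lam : fam_eps lam 0 = 1. Proof. by []. Qed.

Definition fam (lam : Zp) : topGroupType := aff p_pr (fam_eps0 lam).

Lemma fam_epsE lam i : fam_eps lam i = 1 \/ fam_eps lam i = lam.
Proof. by rewrite /fam_eps; case: ifP; [left | right]. Qed.

Lemma fam_commensurable (lam mu : Zp) : lam 1%N = 0 -> mu 1%N = 0 ->
  commensurable (fam lam) (fam mu) -> lam = mu.
Proof.
move=> lam0 mu0 [H [K [sH oH sK oK [f [g [fK gK fM _ _]]]]]].
have one_neq (x : Zp) : x 1%N = 0 -> x <> 1.
  move=> x0 x1; move: x0; rewrite x1 [LHS](rep1 p 1) expn1 modz_small //.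
  by rewrite ltz_nat prime_gt1.
have [n nH] := open_subgroup_congruence sH oH.
have mu1 : fam_eps mu 1 = 1 by [].
have ev := iso_eigenvalue sH sK oK fK gK fM mu1 nH.
have two0 : (inord 2 : 'I_k.+3) != 0 by rewrite -val_eqE /= inordK.
(* Compare the eigenvalues [t] and [t ^ lam] with [t'] and [t' ^ mu]. *)
have [[i1 _ E1] [i2 _ E2]] := (ev 1 isT, ev (inord 2) two0).
rewrite {1}/fam_eps inordK //= in E2; rewrite {1}/fam_eps /= in E1.
set s := (p ^ n)%:R in E1 E2; set s' := (f _ 0 0) in E1 E2.
have s0 : s <> 0 by apply: pX_neq0.
have [e1|e1] := fam_epsE mu i1; rewrite e1 in E1.
  have ss : s = s'.
    move: E1; rewrite !pexp1 => /addrI/eqP; rewrite -subr_eq0 -mulrBr => /eqP.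
    case/(padic_mulf_eq0 p_pr) => [|/eqP]; last by rewrite subr_eq0 => /eqP.
    by move/padic_nat_neq0 => []; rewrite // qpowE expn_gt0 prime_gt0.
  rewrite -ss in E2; move/(pexp_inj s0): E2 => lamE.
  have [e2|e2] := fam_epsE mu i2; rewrite e2 in lamE => //.
  by case: (one_neq _ lam0).
have [e2|e2] := fam_epsE mu i2; rewrite e2 in E2; last first.
  by rewrite -E1 in E2; move/(pexp_inj s0): E2 => /one_neq; case.
rewrite (pexp_pexp mu (esym E2)) in E1.
by move/(pexp_inj s0): E1 => /esym/one_neq; case; apply: pvalM0.
Qed.

End TwoExponents.

(** * Lower bounds for generators and relations *)

(** The pairs [(a, b)] of vectors over [F_p], to be multiplied by
    [(a, b) * (a', b') = (a + a', b + b' + pairing a a')] where the [k]-th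
    coordinate of the pairing is [a (l k) * a' (r k)]. The maps [l] and [r] are
    arguments of the type so that the group law can be inferred from it. *)
Definition heisenberg (p m N : nat) (l r : 'I_N -> 'I_m) : Type :=
  ('rV['F_p]_m * 'rV['F_p]_N)%type.

Section Heisenberg.
Variables (p m N : nat) (l r : 'I_N -> 'I_m).
Notation heis := (heisenberg p l r).

HB.instance Definition _ := Finite.copy heis ('rV['F_p]_m * 'rV['F_p]_N)%type.

Implicit Types (x y : heis).

Definition pairing (a b : 'rV['F_p]_m) : 'rV['F_p]_N :=
  \row_k (a 0 (l k) * b 0 (r k)).

Lemma pairingDl a b c : pairing (a + b) c = pairing a c + pairing b c.
Proof. by apply/rowP => k; rewrite !mxE mulrDl. Qed.

Lemma pairingDr a b c : pairing a (b + c) = pairing a b + pairing a c.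
Proof. by apply/rowP => k; rewrite !mxE mulrDr. Qed.

Lemma pairingNl a b : pairing (- a) b = - pairing a b.
Proof. by apply/rowP => k; rewrite !mxE mulNr. Qed.

Lemma pairingNr a b : pairing a (- b) = - pairing a b.
Proof. by apply/rowP => k; rewrite !mxE mulrN. Qed.

Lemma pairing0l b : pairing 0 b = 0.
Proof. by apply/rowP => k; rewrite !mxE mul0r. Qed.

Lemma pairing0r a : pairing a 0 = 0.
Proof. by apply/rowP => k; rewrite !mxE mulr0. Qed.

Definition heis_mul x y : heis := (x.1 + y.1, x.2 + y.2 + pairing x.1 y.1).
Definition heis_one : heis := (0, 0).
Definition heis_inv x : heis := (- x.1, - x.2 + pairing x.1 x.1).

Fact heis_mulA : associative heis_mul.
Proof.
move=> x y z; rewrite /heis_mul /= pairingDl pairingDr addrA; congr (_, _).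
by apply/rowP => k; rewrite !mxE; ring.
Qed.

Fact heis_mul1 : left_id heis_one heis_mul.
Proof. by case=> a b; rewrite /heis_mul /= pairing0l !add0r addr0. Qed.

Fact heis_mulr1 : right_id heis_one heis_mul.
Proof. by case=> a b; rewrite /heis_mul /= pairing0r !addr0. Qed.

Fact heis_mulVl : left_inverse heis_one heis_inv heis_mul.
Proof.
case=> a b; rewrite /heis_mul /= pairingNl addNr; congr (_, _).
by rewrite -addrA [b + _]addrC addrA addrK addNr.
Qed.

Fact heis_mulV : right_inverse heis_one heis_inv heis_mul.
Proof.
by case=> a b; rewrite /heis_mul /= pairingNr subrr addrA addrK subrr.
Qed.

HB.instance Definition _ := isGroup.Build heis
  heis_mulA heis_mul1 heis_mulr1 heis_mulVl heis_mulV.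

Fact heis_openI : setI_closed [set: set heis]. Proof. by []. Qed.
Fact heis_open_bigU (I : Type) (f : I -> set heis) :
  (forall i, [set: set heis] (f i)) -> [set: set heis] (\bigcup_i f i).
Proof. by []. Qed.

HB.instance Definition _ := isOpenTopological.Build heis
  (I : [set: set heis] setT) heis_openI heis_open_bigU.

Lemma heis_nbhs x (U : set heis) : U x -> nbhs x U.
Proof. by move=> Ux; apply: open_nbhs_nbhs; split. Qed.

Fact heis_mul_continuous : continuous (fun xy : heis * heis => (xy.1 * xy.2)%g).
Proof.
move=> [x y] U /nbhs_singleton Uxy; exists ([set x], [set y]) => /=.
  by split; apply: heis_nbhs.
by move=> [x' y'] /= [-> ->].
Qed.

Fact heis_inv_continuous : continuous (fun x : heis => x^-1%g).
Proof. by move=> x U /nbhs_singleton Ux; apply: heis_nbhs. Qed.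

HB.instance Definition _ := Group_isTopologicalGroup.Build heis
  heis_mul_continuous heis_inv_continuous.

Lemma heis_mulE x y : (x * y)%g = (x.1 + y.1, x.2 + y.2 + pairing x.1 y.1) :> heis.
Proof. by []. Qed.

Lemma heis_oneE : (1%g : heis) = (0, 0). Proof. by []. Qed.

Lemma heis_expE x n :
  (x ^+ n)%g = (x.1 *+ n, x.2 *+ n + pairing x.1 x.1 *+ 'C(n, 2)) :> heis.
Proof.
elim: n => [|n IHn]; first by rewrite !mulr0n addr0.
rewrite expgS {}IHn heis_mulE /= -!mulrS binS bin1 mulrnDr; congr (_, _).
rewrite (_ : pairing x.1 (x.1 *+ n) = pairing x.1 x.1 *+ n).
  by rewrite mulrS -!addrA.
by elim: n => [|n IHn]; rewrite ?mulr0n ?pairing0r // !mulrS pairingDr IHn.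
Qed.

Lemma heis_commg x y :
  [~ x, y]%g = (0, pairing x.1 y.1 - pairing y.1 x.1) :> heis.
Proof.
have := commgC x y; case: [~ x, y]%g => c1 c2; rewrite !heis_mulE /= => -[E1 E2].
have c10 : c1 = 0.
  by apply: (@addrI _ (y.1 + x.1)); rewrite addr0 -E1 addrC.
rewrite c10 pairing0r addr0 in E2; congr (_, _) => //.
apply: (@addrI _ (y.2 + x.2 + pairing y.1 x.1)); rewrite -E2.
by rewrite -[y.2 + x.2 + _ + _]addrA [pairing y.1 _ + _]addrC subrK [y.2 + _]addrC.
Qed.

Lemma heis_conj a y : (((0, a) : heis) ^ y)%g = (0, a).
Proof.
have := conjgC ((0, a) : heis) y; case: (_ ^ y)%g => c1 c2.
rewrite !heis_mulE /= => -[E1 E2].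
have c10 : c1 = 0 by apply: (@addrI _ y.1); rewrite addr0 -E1 add0r.
rewrite c10 pairing0r pairing0l !addr0 in E2; congr (_, _) => //.
by apply: (@addrI _ y.2); rewrite -E2 addrC.
Qed.

Hypothesis p_pr : prime p.

Lemma Fp_mulrn (M K n : nat) (a : 'M['F_p]_(M, K)) : (p %| n)%N -> a *+ n = 0.
Proof.
move=> /dvdnP[k ->]; apply/matrixP => i j; rewrite mulmxnE mxE mulnC mulrnA.
by rewrite (mulrn_pchar (pchar_Fp p_pr)) mul0rn.
Qed.

Lemma heis_exponent x : (x ^+ qpow p)%g = 1%g.
Proof.
rewrite heis_expE !Fp_mulrn ?addr0 ?heis_oneE ?dvdp_q //.
rewrite /qpow; case: (p =P 2%N) => [->//|/eqP p2].
by rewrite prime_dvd_bin //= ltn_neqAle eq_sym p2 prime_gt1.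
Qed.

Lemma heis_pro_p : pro_p p heis.
Proof.
apply: pro_p_criterion => //.
- by apply: finite_compact; apply: finite_finset.
- move=> x y xy.
  have [z [/= -> ->]//] := xy [set x] [set y] (heis_nbhs erefl) (heis_nbhs erefl).
- move=> U /nbhs_singleton U1; exists [set 1%g]; split=> //; last by move=> _ ->.
  by split=> // _ _ -> ->; rewrite /= invg1 mulg1.
move=> M x [[M1 _] _] _; exists (qexp p).
by rewrite -qpowE heis_exponent.
Qed.

End Heisenberg.

Section Reduction.
Variables (p : nat) (p_pr : prime p) (m : nat).
Notation Zp := (padic_int p).
Variables (eps : 'I_m.+1 -> Zp) (eps0 : eps 0 = 1).
Notation G := (aff p_pr eps0).
Implicit Types (v w : G).

(** Reduction modulo [p] is a homomorphism onto an elementary abelian group, as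
    the action of one-units is trivial modulo [p]. *)
Definition red v : 'rV['F_p]_m.+1 := \row_i (v 0 i 1%N)%:~R.

Lemma Fp_modz (a : int) : ((a %% p)%Z%:~R : 'F_p) = a%:~R.
Proof.
rewrite /modz intrD mulrNz intrM -[p%:Z%:~R]/(p%:R) pchar_Fp_0 //.
by rewrite mulr0 oppr0 addr0.
Qed.

Lemma red_mul v w : red (v * w)%g = red v + red w.
Proof.
apply/rowP => i; rewrite !mxE -intrD -[RHS]Fp_modz; congr (_%:~R).
rewrite -[RHS](repD (rep_refl 1 (v 0 i)) (rep_refl 1 (w 0 i))) ?expn1 //.
have [y ->] := aff_char_unit v i.
apply: pvalD_congr => //; rewrite mulrDl mul1r.
rewrite -[w 0 i in RHS]addr0; apply: pvalD_congr => //.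
have /dvdnP[k ->] := dvdp_q p; rewrite pval0 natrM -!mulrA mulrCA.
by have := pX_level p_pr 1 (k%:R * (y * w 0 i)); rewrite expn1.
Qed.

Lemma red_one : red 1%g = 0.
Proof. by apply/rowP => i; rewrite !mxE pval0. Qed.

Lemma red_inv v : red v^-1%g = - red v.
Proof. by apply: (addrI (red v)); rewrite -red_mul mulgV red_one subrr. Qed.

Lemma red_gen i : red (gen p_pr eps0 i) = delta_mx 0 i.
Proof.
apply/rowP => j; rewrite !mxE eqxx /=.
case: (j == i); last by rewrite [_%:R]/(0 : Zp) pval0.
by rewrite [_%:R]/(1 : Zp) (rep1 p 1) Fp_modz.
Qed.

Lemma nbhs_red v (U : set G) :
  (forall w, red w = red v -> U w) -> nbhs v U.
Proof.
move=> Uv; apply/nbhs_row; exists 1%N => w wv; apply: Uv.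
by apply/rowP => i; rewrite !mxE wv.
Qed.

Lemma aff_gens_ge k : gen_by G k -> (m.+1 <= k)%N.
Proof.
case=> s sG; pose M := \matrix_(i < k) red (s i).
suff: row_full M by move/eqP <-; apply: rank_leq_row.
rewrite -sub1mx; apply/row_subP => i; rewrite row1 -(red_gen i).
have : closed_gen (range s) (gen p_pr eps0 i) by rewrite sG.
apply: (closed_gen_sub (H := [set v | (red v <= M)%MS])).
- split=> [|v w Mv Mw] /=; first by rewrite red_one sub0mx.
  by rewrite red_mul red_inv addmx_sub // eqmx_opp.
- move=> v cv; have [|w [/= Mw wv]] := cv [set w | red w = red v].
    exact: nbhs_red.
  by rewrite /= -wv.
by move=> _ [j _ <-] /=; rewrite -(rowK (fun j => red (s j)) j) row_sub.
Qed.

Lemma aff_min_gens : min_gens G m.+1.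
Proof. by split; [apply: aff_gen_by | apply: aff_gens_ge]. Qed.

End Reduction.

Section Relations.
Variables (p : nat) (p_pr : prime p) (m : nat).
Notation Zp := (padic_int p).
Notation q := (qpow p).
Variables (eps : 'I_m.+1 -> Zp) (eps0 : eps 0 = 1).
Notation G := (aff p_pr eps0).

Definition pairs := [pred ij : 'I_m.+1 * 'I_m.+1 | (ij.1 < ij.2)%N].

Lemma card_pairs : #|pairs| = 'C(m.+1, 2).
Proof.
rewrite -bin2_sum big_mkord -sum1_card.
rewrite (eq_bigl (fun ij : 'I_m.+1 * 'I_m.+1 => xpredT ij.1 && (ij.1 < ij.2)%N)) //.
rewrite -(pair_big_dep xpredT (fun i j : 'I_m.+1 => (i < j)%N) (fun _ _ => 1%N)).
rewrite (exchange_big_dep xpredT) //; apply: eq_bigr => j _.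
rewrite (big_ord_narrow (ltnW (ltn_ord j))).
by rewrite sum1_card card_ord.
Qed.

Definition pair_fst (k : 'I_#|pairs|) := (enum_val k).1.
Definition pair_snd (k : 'I_#|pairs|) := (enum_val k).2.

(** The group of class two in which the commutators of the basis elements are
    independent: it detects each relation that expresses a commutator of
    generators. *)
Notation H := (heisenberg p pair_fst pair_snd).

(** The map from [F] to [F_p ^ m] lifts to a homomorphism [phi] to the group of
    class two. It sends the kernel of [f] to the span of the images of the [k]
    relators, in the central factor. As each commutator of generators of [aff] is
    a [q]-th power in [aff], while [q]-th powers vanish in the group of class two,
    this span contains all the basis vectors of the central factor. *)
Lemma commg_detect n k (F : topGroupType) (e : 'I_n -> F) (rel : 'I_k -> F) f :
  free_pro_p p e -> continuous_hom f -> range f = [set: G] ->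
  [set x | f x = 1%g] = closed_normal_closure (range rel) -> (#|pairs| <= k)%N.
Proof.
move=> [_ freeF] [fM fc] fS kerf.
pose u i : H := (red (f (e i)), 0).
have [phi [[[phiM phic] phie] _]] := freeF H u (heis_pro_p _ _ p_pr).
have phi1 x : (phi x).1 = red (f x).
  (* With no pairing coordinate the group of class two is [F_p ^ m] itself. *)
  pose l0 (i : 'I_0) : 'I_m.+1 := 0.
  pose V : topGroupType := heisenberg p l0 l0.
  have [psi [_ psiU]] := freeF V (fun i => (red (f (e i)), 0)) (heis_pro_p _ _ p_pr).
  pose psi1 x : V := ((phi x).1, 0); pose psi2 x : V := (red (f x), 0).
  have e0 (a b : 'rV['F_p]_0) : a = b by apply/rowP => -[].
  have E1 : psi = psi1.
    apply: psiU; split; last by move=> i; rewrite /psi1 phie.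
    split=> [y z|y U /nbhs_singleton Uy].
      by rewrite /psi1 phiM; congr (_, _); apply: e0.
    change (nbhs y (psi1 @^-1` U)).
    have n1 : nbhs y (phi @^-1` [set h : H | U (h.1, 0)]) by apply/phic/heis_nbhs.
    by apply: filterS n1.
  have E2 : psi = psi2.
    apply: psiU; split=> //; split=> [y z|y U /nbhs_singleton Uy].
      by rewrite /psi2 fM red_mul; congr (_, _); apply: e0.
    have nU : nbhs (f y) [set v | U (red v, 0)] by apply: nbhs_red => w /= ->.
    change (nbhs y (psi2 @^-1` U)).
    have n2 : nbhs y (f @^-1` [set v | U (red v, 0)]) by apply: fc.
    by apply: filterS n2.
  by have := congr1 (fun h : F -> V => (h x).1) (etrans (esym E1) E2).
pose W := \matrix_(i < k) (phi (rel i)).2.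
pose S := [set x | (phi x).1 = 0 /\ ((phi x).2 <= W)%MS].
have sub : closed_normal_closure (range rel) `<=` S.
  apply: closed_normal_closure_sub.
  - split; first split.
    + by rewrite /S /= (hom_one phiM) sub0mx.
    + move=> x y [x1 x2] [y1 y2]; rewrite /S /= phiM (hom_inv phiM).
      rewrite heis_mulE /= x1 y1 oppr0 addr0 pairing0l !addr0; split=> //.
      by rewrite addmx_sub // eqmx_opp.
    + move=> x g [x1 x2]; rewrite /S /= (hom_conj phiM).
      have -> : phi x = ((0, (phi x).2) : H) by rewrite -x1 -surjective_pairing.
      by rewrite heis_conj.
  - move=> x cx; have [|y [[y1 y2] /= yx]] := cx [set y | phi y = phi x].
      exact: (phic x [set h | h = phi x] (heis_nbhs _)).
    by rewrite /S /= -yx.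
  - move=> _ [i _ <-]; split; last by rewrite -(rowK (fun j => (phi (rel j)).2) i) row_sub.
    have : [set x | f x = 1%g] (rel i).
      by rewrite kerf; apply: sub_closed_normal_closure; exists i.
    by move=> /= fr; rewrite phi1 fr red_one.
suff: row_full W by move/eqP <-; apply: rank_leq_row.
rewrite -sub1mx; apply/row_subP => d; rewrite row1.
have lt_d : ((enum_val d).1 < (enum_val d).2)%N := enum_valP d.
have fsurj y : exists x, f x = y.
  by have : range f y by [rewrite fS]; case=> x _ <-; exists x.
have [x1 fx1] := fsurj (gen p_pr eps0 (pair_fst d)).
have [x2 fx2] := fsurj (gen p_pr eps0 (pair_snd d)).
have [w [_ wE]] := q_translation_root (commg_q_translations (f x1) (f x2)).
have [h fh] := fsurj w.
have Sr : S ([~ x1, x2] * (h ^+ q)^-1)%g.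
  apply: sub; rewrite -kerf /= fM (hom_comm fM) (hom_inv fM) (hom_exp fM) fh wE.
  by rewrite mulgV.
have := Sr.2; rewrite phiM (hom_comm phiM) (hom_inv phiM) (hom_exp phiM).
rewrite heis_exponent // invg1 mulg1 heis_commg /= !phi1 fx1 fx2 !red_gen.
congr (_ <= _)%MS; apply/rowP => d'; rewrite !mxE !eqxx /=.
have lt_d' : ((enum_val d').1 < (enum_val d').2)%N := enum_valP d'.
have -> : (d' == d) = (pair_fst d' == pair_fst d) && (pair_snd d' == pair_snd d).
  rewrite -(inj_eq enum_val_inj) /pair_fst /pair_snd.
  by case: (enum_val d') (enum_val d) => [i j] [i' j'].
have -> : (pair_snd d' == pair_fst d) = (pair_snd d' == pair_fst d) &&
    (pair_fst d' != pair_snd d).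
  case: eqP => // /(congr1 val) /= E; apply/esym/eqP => /(congr1 val) /= E'.
  rewrite /pair_fst /pair_snd in E E'; move: lt_d.
  by rewrite -E -E' ltnNge (ltnW lt_d').
case: (pair_fst d' == pair_fst d); case: (pair_snd d' == pair_snd d);
case: (pair_fst d' == pair_snd d); case: (pair_snd d' == pair_fst d) => /=; ring.
Qed.

Lemma aff_rels_ge n k : has_presentation p G n k -> ('C(m.+1, 2) <= k)%N.
Proof.
case=> F [e [rel [f [freeF hf _ fS kerf]]]]; rewrite -card_pairs.
exact: commg_detect freeF hf fS kerf.
Qed.

End Relations.

Local Close Scope ring_scope.

(** * Free pro-p groups *)

Section ProPSeparation.
Local Open Scope group_scope.
Variables (p : nat) (P : topGroupType).
Hypothesis pP : pro_p p P.

Lemma pro_p_normal_base (U : set P) : nbhs 1 U ->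
  exists N, [/\ normal_subgroup N, open N & N `<=` U].
Proof.
case: pP => cP _ bP _ /bP[H [sH oH HU]].
have [N [nN oN NH]] := open_normal_core cP sH oH.
by exists N; split=> //; apply: subset_trans NH HU.
Qed.

Lemma pro_p_normal_nbhs (x : P) (U : set P) : nbhs x U ->
  exists N, [/\ normal_subgroup N, open N & forall y, N (x^-1 * y) -> U y].
Proof.
move=> xU; have [|N [nN oN NU]] := @pro_p_normal_base [set y | U (x * y)].
  by apply: mulgl_continuous; rewrite mulg1.
by exists N; split=> // y /NU /=; rewrite mulVKg.
Qed.

Lemma pro_p_separated (x y : P) :
  (forall N, normal_subgroup N -> open N -> N (x^-1 * y)) -> x = y.
Proof.
case: (pP) => _ hP _ _ xy; apply: hP => U V /pro_p_normal_nbhs[N [nN oN NU]].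
move=> /nbhs_singleton Vy; exists y; split=> //; apply: NU; exact: xy.
Qed.

End ProPSeparation.

Section FreeProP.
Variables (p n : nat).
Hypothesis p_pr : prime p.
Notation word := (seq 'I_n).

Definition wpow k (w : word) : word := flatten (nseq k w).

(** A finite [p]-group generated by [n] elements, presented as the map sending
    a positive word to the label of its value. As inverses are positive powers
    in a finite group, positive words suffice. *)
Record marked_quotient := MarkedQuotient {
  label :> word -> nat;
  label_bound : nat;
  label_lt : forall w, (label w < label_bound)%N;
  label_cat : forall v v' w w', label v = label v' -> label w = label w' ->
    label (v ++ w) = label (v' ++ w');
  label_exp : forall w, exists k, label (wpow (p ^ k) w) = label [::]
}.

Implicit Types (k : marked_quotient) (s : seq marked_quotient) (w : word).

(** Membership in the closure of the words. *)
Definition approximable (x : marked_quotient -> nat) := forall s,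
  exists w, forall k, List.In k s -> x k = k w.

(** The closure of the words in the product of all marked finite [p]-groups. It
    will be the free pro-[p] group. *)
Record coherent_family := CoherentFamily {
  value :> marked_quotient -> nat;
  _ : `[< approximable value >]
}.

HB.instance Definition _ := [isSub for value].
HB.instance Definition _ := [Choice of coherent_family by <:].

(** Primality, which the inverses depend on, is part of the type so that the group
    structure can be inferred from it. *)
Definition free_group & prime p : Type := coherent_family.
Notation free := (free_group p_pr).

HB.instance Definition _ := Choice.copy free coherent_family.

Implicit Types (x y z : free).

Lemma freeP x y : (forall k, x k = y k) -> x = y.
Proof. by move=> xy; apply/val_inj/funext. Qed.

Lemma free_approx x s : exists w, forall k, List.In k s -> x k = k w.
Proof. by case: x => x /= /asboolP; apply. Qed.

Lemma free_word x k : exists w, x k = k w.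
Proof. by have [w wP] := free_approx x [:: k]; exists w; apply: wP; left. Qed.

Definition word_at x k : word := projT1 (cid (free_word x k)).

Lemma word_atE x k : x k = k (word_at x k).
Proof. by rewrite /word_at; case: (cid _). Qed.

Lemma wpowS j w : wpow j.+1 w = w ++ wpow j w. Proof. by []. Qed.

Lemma wpowD i j w : wpow (i + j) w = wpow i w ++ wpow j w.
Proof. by elim: i => // i IHi; rewrite addSn !wpowS IHi catA. Qed.

Lemma wpowM i j w : wpow (i * j) w = wpow j (wpow i w).
Proof. by elim: j => [|j IHj]; rewrite ?muln0 // mulnS wpowD IHj. Qed.

Lemma label_wpow k j v w : k v = k w -> k (wpow j v) = k (wpow j w).
Proof. by move=> vw; elim: j => // j IHj; rewrite !wpowS; apply: label_cat. Qed.

Lemma wpow_nil j : wpow j [::] = [::].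
Proof. by elim: j. Qed.

Lemma label_exp_le k w i j : (i <= j)%N -> k (wpow (p ^ i) w) = k [::] ->
  k (wpow (p ^ j) w) = k [::].
Proof.
move=> ij /(label_wpow (p ^ (j - i))); rewrite wpow_nil -wpowM -expnD.
by rewrite subnKC.
Qed.

Lemma label_exp_seq s w : exists i, forall k, List.In k s ->
  k (wpow (p ^ i) w) = k [::].
Proof.
elim: s => [|k s [i IHs]]; first by exists 0%N.
have [j kj] := label_exp k w; exists (maxn i j) => k' /= [<-|/IHs].
  by apply: label_exp_le kj; apply: leq_maxr.
by apply: label_exp_le; apply: leq_maxl.
Qed.

Lemma wpow_inv i w : wpow (p ^ i) w = w ++ wpow (p ^ i).-1 w.
Proof. by rewrite -wpowS prednK // expn_gt0 prime_gt0. Qed.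

Lemma label_inv k w : exists v, k (w ++ v) = k [::].
Proof.
by have [i ki] := label_exp k w; exists (wpow (p ^ i).-1 w); rewrite -wpow_inv.
Qed.

(** Some power of [w] is a left inverse of [w] for the labels, so all right
    inverses of [w] have the same label. *)
Lemma label_inv_uniq k w w' v v' : k w = k w' ->
  k (w ++ v) = k [::] -> k (w' ++ v') = k [::] -> k v = k v'.
Proof.
move=> ww' wv wv'; have [i ki] := label_exp k w.
pose u := wpow (p ^ i).-1 w.
have uw : k (u ++ w) = k [::].
  rewrite -ki /u; congr (k _); rewrite -{2}(cats0 w) -[w ++ [::]]/(wpow 1 w).
  by rewrite -wpowD addn1 prednK // expn_gt0 prime_gt0.
have E (z : word) : k (w ++ z) = k [::] -> k z = k u.
  move=> wz; have := label_cat (erefl (k u)) wz; rewrite cats0 => <-.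
  by rewrite catA (label_cat uw (erefl (k z))).
by rewrite (E v wv) -(E v') // -wv'; apply: label_cat.
Qed.

Definition inv_at x k : word := projT1 (cid (label_inv k (word_at x k))).

Lemma inv_atP x k : k (word_at x k ++ inv_at x k) = k [::].
Proof. by rewrite /inv_at; case: (cid _). Qed.

Fact emb_approx w : `[< approximable (fun k => k w) >].
Proof. by apply/asboolP => s; exists w. Qed.

Definition emb w : free := CoherentFamily (emb_approx w).

Fact free_mul_approx x y :
  `[< approximable (fun k => k (word_at x k ++ word_at y k)) >].
Proof.
apply/asboolP => s; have [v xv] := free_approx x s; have [w yw] := free_approx y s.
by exists (v ++ w) => k ks; apply: label_cat; rewrite -word_atE ?xv ?yw.
Qed.

Definition free_mul x y : free := CoherentFamily (free_mul_approx x y).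

Fact free_inv_approx x : `[< approximable (fun k => k (inv_at x k)) >].
Proof.
apply/asboolP => s; have [w xw] := free_approx x s.
have [i si] := label_exp_seq s w; exists (wpow (p ^ i).-1 w) => k ks.
apply: (label_inv_uniq (w := word_at x k) (w' := w)); last by rewrite -wpow_inv si.
  by rewrite -word_atE xw.
exact: inv_atP.
Qed.

Definition free_inv x : free := CoherentFamily (free_inv_approx x).

Lemma free_mulE x y k v w : x k = k v -> y k = k w -> free_mul x y k = k (v ++ w).
Proof. by move=> xv yw; apply: label_cat; rewrite -word_atE. Qed.

Fact free_mulA : associative free_mul.
Proof.
move=> x y z; apply: freeP => k.
have [[xu yv] zw] := (word_atE x k, word_atE y k, word_atE z k).
rewrite (free_mulE xu (free_mulE yv zw)) (free_mulE (free_mulE xu yv) zw).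
by rewrite catA.
Qed.

Fact free_mul1 : left_id (emb [::]) free_mul.
Proof.
move=> x; apply: freeP => k.
by rewrite (free_mulE (erefl : emb [::] k = k [::]) (word_atE x k)) -word_atE.
Qed.

Fact free_mulr1 : right_id (emb [::]) free_mul.
Proof.
move=> x; apply: freeP => k; rewrite (free_mulE (word_atE x k) (erefl : emb [::] k = k [::])).
by rewrite cats0 -word_atE.
Qed.

Fact free_mulV : right_inverse (emb [::]) free_inv free_mul.
Proof.
move=> x; apply: freeP => k.
by rewrite (free_mulE (word_atE x k) (erefl : free_inv x k = k (inv_at x k))) inv_atP.
Qed.

Fact free_mulVl : left_inverse (emb [::]) free_inv free_mul.
Proof.
move=> x; rewrite -[LHS]free_mulr1 -(free_mulV (free_inv x)) free_mulA.
by rewrite -(free_mulA _ x) free_mulV free_mulr1.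
Qed.

HB.instance Definition _ := isGroup.Build free
  free_mulA free_mul1 free_mulr1 free_mulVl free_mulV.

Definition coord k x : nat := x k.

Definition free_open : set_system free :=
  [set U | forall x, U x -> exists s, forall y, agree coord s x y -> U y].

Fact free_openT : free_open setT.
Proof. by move=> x _; exists [::]. Qed.

Lemma agree_cat s t x y :
  agree coord (s ++ t) x y -> agree coord s x y /\ agree coord t x y.
Proof.
by move=> st; split=> k ks; apply/st/List.in_or_app; [left | right].
Qed.

Fact free_openI : setI_closed free_open.
Proof.
move=> U V oU oV x [/oU[s sU] /oV[t tV]]; exists (s ++ t) => y.
by case/agree_cat => /sU Uy /tV Vy.
Qed.

Fact free_open_bigU (I : Type) (f : I -> set free) :
  (forall i, free_open (f i)) -> free_open (\bigcup_i f i).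
Proof. by move=> of_ x [i _ /of_[s sf]]; exists s => y /sf; exists i. Qed.

HB.instance Definition _ := isOpenTopological.Build free
  free_openT free_openI free_open_bigU.

Lemma nbhs_coord x U : nbhs x U <-> exists s, forall y, agree coord s x y -> U y.
Proof.
rewrite nbhsE; split=> [[B [oB Bx] sBU]|[s sU]].
  by have [s sB] := oB x Bx; exists s => y /sB /sBU.
exists [set y | agree coord s x y] => //; split=> //.
have : free_open [set y | agree coord s x y].
  by move=> y xy; exists s => z yz k ks; rewrite yz // xy.
exact.
Qed.

Local Open Scope group_scope.

Lemma mul_coord x y k v w : x k = k v -> y k = k w -> (x * y) k = k (v ++ w).
Proof. exact: free_mulE. Qed.

Lemma mul_congr x x' y y' k : x k = x' k -> y k = y' k -> (x * y) k = (x' * y') k.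
Proof.
move=> xx yy; have [xv yw] := (word_atE x k, word_atE y k).
rewrite (mul_coord xv yw); rewrite xx in xv; rewrite yy in yw.
by rewrite (mul_coord xv yw).
Qed.

Lemma inv_congr x y k : x k = y k -> x^-1 k = y^-1 k.
Proof.
move=> xy; apply: (label_inv_uniq _ (inv_atP x k) (inv_atP y k)).
by rewrite -!word_atE.
Qed.

Fact free_mul_continuous : continuous (fun xy : free * free => xy.1 * xy.2).
Proof.
move=> [x y] U /nbhs_coord[s sU].
exists ([set x' | agree coord s x x'], [set y' | agree coord s y y']) => /=.
  by split; apply/nbhs_coord; exists s.
by move=> [x' y'] /= [xx yy]; apply: sU => k ks; apply: mul_congr; [apply: xx | apply: yy].
Qed.

Fact free_inv_continuous : continuous (fun x : free => x^-1).
Proof.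
move=> x U /nbhs_coord[s sU]; apply/nbhs_coord; exists s => y xy.
by apply: sU => k ks; apply: inv_congr; apply: xy.
Qed.

HB.instance Definition _ := Group_isTopologicalGroup.Build free
  free_mul_continuous free_inv_continuous.

Lemma emb_cat v w : emb (v ++ w) = emb v * emb w.
Proof.
apply: freeP => k.
by rewrite (mul_coord (erefl : emb v k = k v) (erefl : emb w k = k w)).
Qed.

Lemma emb_dense x s : exists w, agree coord s x (emb w).
Proof. by have [w xw] := free_approx x s; exists w => k /xw. Qed.

Lemma exp_coord x k w j : x k = k w -> (x ^+ j) k = k (wpow j w).
Proof.
by move=> xw; elim: j => // j IHj; rewrite expgS (mul_coord xw IHj).
Qed.

Lemma free_is_pro_p : pro_p p free.
Proof.
apply: pro_p_criterion => //.
- apply: (coordinates_compact (b := label_bound) nbhs_coord).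
    by move=> k x; rewrite /coord word_atE label_lt.
  move=> a aP; suff aa : `[< approximable a >] by exists (CoherentFamily aa : free).
  apply/asboolP => s; have [x xa] := aP s; have [w xw] := free_approx x s.
  by exists w => k ks; rewrite -xw // -xa.
- by apply: (coordinates_hausdorff nbhs_coord) => x y; apply: freeP.
- move=> U /nbhs_coord[s sU]; exists [set x | agree coord s 1 x]; split=> //.
    split=> [k //|x y x1 y1 k ks].
    rewrite -[in RHS](mulgV 1); apply: mul_congr; first exact: x1.
    by apply: inv_congr; apply: y1.
  rewrite openE => x x1; apply/nbhs_coord; exists s => y xy k ks.
  by rewrite xy // x1.
move=> N x [[N1 _] _] oN.
have /nbhs_coord[s sN] : nbhs 1 N by apply: open_nbhs_nbhs.
have [w xw] := free_approx x s; have [i si] := label_exp_seq s w.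
by exists i; apply: sN => k ks; rewrite /coord (exp_coord _ (xw k ks)) si.
Qed.

End FreeProP.

Section UniversalProperty.
Local Open Scope group_scope.
Variables (p n : nat) (p_pr : prime p).
Notation free := (free_group n p_pr).
Variables (P : topGroupType) (pP : pro_p p P) (u : 'I_n -> P).
Implicit Types (x y : free) (g h : P) (v w : seq 'I_n) (k : marked_quotient p n).

Definition eval w : P := foldr (fun i g => u i * g) 1 w.

Lemma eval_cat v w : eval (v ++ w) = eval v * eval w.
Proof. by elim: v => [|i v IHv] /=; rewrite ?mul1g // IHv mulgA. Qed.

Lemma eval_wpow j w : eval (wpow j w) = eval w ^+ j.
Proof. by elim: j => // j IHj; rewrite wpowS eval_cat IHj expgS. Qed.

(** [k] is the quotient of [P] by [N], marked by the images of the [u i]. *)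
Definition labels k (N : set P) :=
  forall v w, k v = k w <-> N ((eval v)^-1 * eval w).

Lemma labels_exists N : normal_subgroup N -> open N -> exists k, labels k N.
Proof.
move=> nN oN; have [cP _ _ idxP] := pP; have [K NK] := idxP N nN oN.
have [c [r [cN _]]] := coset_index nN.1 NK; have [j Nj] := pro_p_exponent pP nN oN.
pose lab w : nat := c (eval w).
have labN v w : lab v = lab w <-> N ((eval v)^-1 * eval w).
  by rewrite -cN; split=> [/val_inj //|vw]; rewrite /lab vw.
have lt_lab w : (lab w < p ^ K)%N by apply: ltn_ord.
have cat_lab v v' w w' : lab v = lab v' -> lab w = lab w' ->
    lab (v ++ w) = lab (v' ++ w').
  move=> /labN vv /labN ww; apply/labN; rewrite !eval_cat invgM.
  have -> : (eval w)^-1 * (eval v)^-1 * (eval v' * eval w') =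
      ((eval v)^-1 * eval v') ^ eval w * ((eval w)^-1 * eval w').
    by rewrite conjgE !mulgA mulgK.
  by apply: subgroupM nN.1 _ ww; apply: nN.2.
have exp_lab w : exists i, lab (wpow (p ^ i) w) = lab [::].
  exists j; apply/labN; rewrite eval_wpow mulg1.
  by apply: subgroupV nN.1 _; apply: Nj.
by exists (MarkedQuotient lt_lab cat_lab exp_lab).
Qed.

(** The homomorphism that extends [u] sends [x] to the limit of the values of the
    words that approximate [x]. *)
Definition limit x g := forall N k w, normal_subgroup N -> open N -> labels k N ->
  x k = k w -> N ((eval w)^-1 * g).

(** By compactness: the values of the words that approximate [x] on finitely
    many quotients form a filter base, and any cluster point will do. *)
Lemma limit_exists x : exists g, limit x g.
Proof.
pose C s := [set g : P | exists2 w, g = eval w & forall k, List.In k s -> x k = k w].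
pose F := filter_from [set: seq (marked_quotient p n)] C.
have FF : ProperFilter F.
  apply: filter_from_proper => [|s _].
    apply: filter_from_filter => [|s t _ _]; first by exists [::].
    exists (s ++ t) => // g [w -> st].
    by split; exists w => // k ks; apply/st/List.in_or_app; [left | right].
  by have [w xw] := free_approx x s; exists (eval w); exists w.
have [cP _ _ _] := pP; have [|g [_ gP]] := cP F FF; first by exists [::].
exists g => N k w nN oN kN xw.
have [|_ [[v -> vx] Ngv]] := gP (C [:: k]) _ _ (nbhs_coset g nN.1 oN).
  by exists [:: k].
have Nwv : N ((eval w)^-1 * eval v) by apply/kN; rewrite -xw; apply: vx; left.
have -> : (eval w)^-1 * g = (eval w)^-1 * eval v * (g^-1 * eval v)^-1.
  by rewrite invgM invgK !mulgA mulgK.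
exact: nN.1.2.
Qed.

Lemma limit_uniq x g h : limit x g -> limit x h -> g = h.
Proof.
move=> xg xh; apply: (pro_p_separated pP) => N nN oN.
have [k kN] := labels_exists nN oN; have [w xw] := free_word x k.
have [Ng Nh] := (xg N k w nN oN kN xw, xh N k w nN oN kN xw).
have -> : g^-1 * h = ((eval w)^-1 * g)^-1 * ((eval w)^-1 * h).
  by rewrite invgM invgK !mulgA mulgK.
by apply: subgroupM nN.1 _ Nh; apply: subgroupV nN.1 Ng.
Qed.

Lemma limit_mul x y g h : limit x g -> limit y h -> limit (x * y) (g * h).
Proof.
move=> xg yh N k w nN oN kN xyw.
have [[v xv] [v' yv]] := (free_word x k, free_word y k).
have Nw : N ((eval w)^-1 * (eval v * eval v')).
  by rewrite -eval_cat; apply/kN; rewrite -xyw (mul_coord xv yv).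
have [Ng Nh] := (xg N k v nN oN kN xv, yh N k v' nN oN kN yv).
have -> : (eval w)^-1 * (g * h) = (eval w)^-1 * (eval v * eval v') *
    (((eval v)^-1 * g) ^ eval v' * ((eval v')^-1 * h)).
  by rewrite conjgE !mulgA !mulgK.
apply: subgroupM nN.1 Nw _; apply: subgroupM nN.1 _ Nh; exact: nN.2.
Qed.

Lemma limit_emb w : limit (emb p_pr w) (eval w).
Proof. by move=> N k v _ _ kN vw; apply/kN; rewrite -vw. Qed.

Definition lift x : P := projT1 (cid (limit_exists x)).

Lemma liftP x : limit x (lift x).
Proof. by rewrite /lift; case: (cid _). Qed.

Lemma lift_emb w : lift (emb p_pr w) = eval w.
Proof. exact: (limit_uniq (@liftP _) (@limit_emb w)). Qed.

Lemma liftM : {morph lift : x y / x * y}.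
Proof.
by move=> x y; exact: (limit_uniq (@liftP (x * y)) (limit_mul (@liftP x) (@liftP y))).
Qed.

Lemma lift_continuous : continuous lift.
Proof.
move=> x U /(pro_p_normal_nbhs pP)[N [nN oN NU]].
have [k kN] := labels_exists nN oN; have [w xw] := free_word x k.
apply/nbhs_coord; exists [:: k] => y xy; apply: NU.
have yw : y k = k w by rewrite -xw; apply: xy; left.
have [Nx Ny] := (liftP nN oN kN xw, liftP nN oN kN yw).
have -> : (lift x)^-1 * lift y = ((eval w)^-1 * lift x)^-1 * ((eval w)^-1 * lift y).
  by rewrite invgM invgK !mulgA mulgK.
by apply: subgroupM nN.1 _ Ny; apply: subgroupV nN.1 Nx.
Qed.

Lemma hom_eval (f : free -> P) : {morph f : x y / x * y} ->
  (forall i, f (emb p_pr [:: i]) = u i) -> forall w, f (emb p_pr w) = eval w.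
Proof.
move=> fM fu; elim=> [|i w IHw].
  by rewrite -[emb p_pr [::]]/(1 : free) (hom_one fM).
by rewrite -cat1s emb_cat fM fu IHw.
Qed.

Lemma lift_uniq (f : free -> P) : continuous_hom f ->
  (forall i, f (emb p_pr [:: i]) = u i) -> lift = f.
Proof.
move=> [fM fc] fu; apply/funext => x; apply: (limit_uniq (@liftP x) _).
move=> N k w nN oN kN xw.
have /nbhs_coord[s sN] := fc x _ (nbhs_coset (f x) nN.1 oN).
have [v xv] := emb_dense x (k :: s).
have : N ((f x)^-1 * f (emb p_pr v)) by apply: sN => j js; apply: xv; right.
rewrite (hom_eval fM fu) => Nv.
have Nwv : N ((eval w)^-1 * eval v) by apply/kN; rewrite -xw; apply/esym/xv; left.
have -> : (eval w)^-1 * f x = (eval w)^-1 * eval v * ((f x)^-1 * eval v)^-1.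
  by rewrite invgM invgK !mulgA mulgK.
exact: nN.1.2.
Qed.

End UniversalProperty.

(** The second property of [F] is the density of the positive words, in the form
    of an induction principle for closed sets. *)
Lemma free_pro_p_exists p n : prime p -> exists (F : topGroupType) (e : 'I_n -> F),
  free_pro_p p e /\
  forall C : set F, closed C -> C 1%g -> (forall i x, C x -> C (e i * x)%g) ->
  C = [set: F].
Proof.
move=> p_pr; exists (free_group n p_pr), (fun i => emb p_pr [:: i]).
split; first split; first exact: free_is_pro_p.
  move=> P u pP; exists (@lift p n p_pr P pP u); split; first split.
  - by split; [apply: liftM | apply: lift_continuous].
  - by move=> i; rewrite lift_emb /= mulg1.
  - by move=> f [fh fu]; apply: lift_uniq.
move=> C cC C1 CM; apply/seteqP; split=> // x _; apply: cC => U /nbhs_coord[s sU].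
have [w xw] := emb_dense x s; exists (emb p_pr w); split; last exact: sU.
by elim: w {xw} => // i w IHw; rewrite -cat1s emb_cat; apply: CM.
Qed.

(** * A minimal presentation *)

Section ProductSets.
Local Open Scope group_scope.
Variable F : topGroupType.
Implicit Types (A B N : set F) (x y a : F).

(** This form avoids negative exponents. *)
Lemma smallest_cyclic x y : smallest (@subgroup F) [set x] y ->
  exists i k, y * x ^+ k = x ^+ i.
Proof.
apply: (smallest_sub (X := [set y | exists i k, y * x ^+ k = x ^+ i])); last first.
  by move=> _ ->; exists 1%N, 0%N; rewrite mulg1.
split=> [|y' z [i [k yE]] [i' [k' zE]]]; first by exists 0%N, 0%N; rewrite mulg1.
exists (i + k')%N, (i' + k)%N; rewrite !expgnDr -yE -zE mulgA -(mulgA y').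
by rewrite (mulgA z^-1) mulVg mul1g -!mulgA -!expgnDr addnC.
Qed.

Definition mulset A B : set F := [set x | exists a b, [/\ A a, B b & x = a * b]].

Lemma mulset_compact A B : compact A -> compact B -> compact (mulset A B).
Proof.
move=> cA cB; have -> : mulset A B = (fun ab : F * F => ab.1 * ab.2) @` (A `*` B).
  apply/seteqP; split=> [_ [a [b [Aa Bb ->]]]|_ [[a b] [Aa Bb] <-]].
    by exists (a, b).
  by exists a, b.
apply: continuous_compact; last exact: compact_setX.
by apply: continuous_subspaceT; apply: mulg_continuous.
Qed.

End ProductSets.

Section Presentation.
Local Open Scope group_scope.
Variables (p : nat) (p_pr : prime p) (m : nat).
Notation Zp := (padic_int p).
Variables (eps : 'I_m.+1 -> Zp) (eps0 : eps 0%R = 1%R).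
Notation G := (aff p_pr eps0).
Notation gen := (gen p_pr eps0).
Variables (F : topGroupType) (e : 'I_m.+1 -> F) (f : F -> G).
Hypotheses (pF : pro_p p F)
  (F_dense : forall C : set F, closed C -> C 1 -> (forall i x, C x -> C (e i * x)) ->
     C = [set: F])
  (fM : {morph f : x y / x * y}) (fc : continuous f) (fe : forall i, f (e i) = gen i).
Implicit Types (i j : 'I_m.+1) (x y a : F).

Let compactF : compact [set: F]. Proof. by case: pF. Qed.

Lemma closed_compactF (C : set F) : closed C -> compact C.
Proof. by move=> cC; apply: subclosed_compact cC compactF _. Qed.

Lemma image_closed (C : set F) : closed C -> closed (f @` C).
Proof.
move=> cC; apply: compact_closed; first exact: row_hausdorff.
apply: continuous_compact; last exact: closed_compactF.
exact: continuous_subspaceT.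
Qed.

Lemma mulset_closed (A B : set F) : closed A -> closed B -> closed (mulset A B).
Proof.
move=> cA cB; apply: compact_closed; first by case: pF.
by apply: mulset_compact; apply: closed_compactF.
Qed.

Lemma f_surj : range f = [set: G].
Proof.
apply/seteqP; split=> // v _.
have : closed_gen (range gen) v by rewrite gens_generate.
apply: closed_gen_sub.
- split; first by exists 1; rewrite ?(hom_one fM).
  move=> _ _ [x _ <-] [y _ <-]; exists (x * y^-1) => //.
  by rewrite fM (hom_inv fM).
- by apply: image_closed; apply: closedT.
by move=> _ [i _ <-]; exists (e i).
Qed.

Definition procyclic j : set F := closed_gen [set e j].

Definition line j : set G := [set v | forall i, i != j -> v 0%R i = 0%R].

Lemma line_subgroup j : subgroup (line j).
Proof.
split=> [i _|v w vj wj i ij]; first by rewrite aff_oneE.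
by rewrite aff_mulE aff_invE (vj i ij) (wj i ij) mulr0 oppr0 mulr0 addr0.
Qed.

Lemma line_closed j : closed (line j).
Proof.
apply: closed_row => v vj i ij; apply: padicP => n.
by have [w wj <-] := vj n; rewrite wj.
Qed.

Lemma gen_line j : line j (gen j).
Proof. by move=> i /negPf ij; rewrite genE ij. Qed.

Lemma gen_expE j n i : (gen j ^+ n) 0%R i = ((i == j)%:R * geo (aff_char (gen j) i) n)%R.
Proof. by rewrite aff_expE genE mulrC. Qed.

Lemma line_dense j v n : line j v ->
  exists k, forall i, ((gen j ^+ k) 0%R i : Zp) n = v 0%R i n.
Proof.
move=> vj; have [k kE] : exists k, geo (aff_char (gen j) j) k n = v 0%R j n.
  have [->|j0] := eqVneq j 0%R.
    by rewrite aff_char0 genE eqxx; apply: geo_dense.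
  exists (absz (v 0%R j n)); rewrite aff_char_trans ?genE 1?eq_sym ?(negPf j0) //.
  by rewrite geo_one (rep_nat p n (absz (v 0%R j n))) natz pval_absz // pval_mod.
exists k => i; rewrite gen_expE; case: eqP => [->|/eqP ij]; first by rewrite mul1r.
by rewrite mul0r vj.
Qed.

Lemma procyclic_subgroup j : subgroup (procyclic j).
Proof. exact: closed_gen_subgroup. Qed.

Lemma procyclic_closed j : closed (procyclic j).
Proof. exact: closed_closure. Qed.

Lemma procyclic_gen j : procyclic j (e j).
Proof. exact: sub_closed_gen. Qed.

Lemma procyclic_line j x : procyclic j x -> line j (f x).
Proof.
apply: (closed_gen_sub (H := f @^-1` line j)).
- have [l1 lV] := line_subgroup j; split=> [|y z ly lz].
    by rewrite /preimage /= (hom_one fM).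
  by rewrite /preimage /= fM (hom_inv fM); apply: lV.
- by apply: preimage_closed (@line_closed j) => y _; apply: fc.
by move=> _ ->; rewrite /preimage /= fe; apply: gen_line.
Qed.

Lemma line_procyclic j v : line j v -> exists2 x, procyclic j x & f x = v.
Proof.
move=> vj; have cl : closed (f @` procyclic j) by apply: image_closed; apply: procyclic_closed.
suff [x px fx] : (f @` procyclic j) v by exists x.
apply: cl => U /nbhs_row[n nU]; have [k kv] := line_dense n vj.
exists (gen j ^+ k); split; last exact: nU.
exists (e j ^+ k); last by rewrite (hom_exp fM) fe.
exact: (subgroupX k (procyclic_subgroup j) (@procyclic_gen j)).
Qed.

(** [f] is injective on the procyclic subgroups: if a power of [gen j] is close
    to 1 then its exponent is divisible by a large power of [p], so the same
    power of [e j] is close to 1 as well. *)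
Lemma procyclic_inj j x : procyclic j x -> f x = 1 -> x = 1.
Proof.
move=> px fx1; apply: (pro_p_separated pF) => N nN oN; rewrite mulg1.
have [K NK] := pro_p_exponent pF nN oN.
have sC := @congruence_subgroupP p p_pr m eps eps0 K.
have small n : congruence_subgroup K (gen j ^+ n) -> N (e j ^+ n).
  move=> /(_ j); rewrite gen_expE eqxx mul1r; have [y ->] := aff_char_unit (gen j) j.
  move=> /(geo_level p_pr)/dvdnP[c ->]; rewrite mulnC expgnA.
  exact: (subgroupX c nN.1 (NK _)).
have [y [/smallest_cyclic[i [k yE]] [Nxy Cy]]] :
    (smallest (@subgroup F) [set e j] `&`
     ([set y | N (x^-1 * y)] `&` f @^-1` congruence_subgroup K)) !=set0.
  apply: px; apply: filterI; first exact: nbhs_coset nN.1 oN.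
  apply: fc; apply: open_nbhs_nbhs; split; first exact: congruence_subgroup_open.
  by rewrite fx1; apply: subgroup1 sC.
have eN n : congruence_subgroup K (f (e j ^+ n)) -> N (e j ^+ n).
  by rewrite (hom_exp fM) fe; apply: small.
suff Ny : N y by rewrite -(mulgK y x^-1); apply: nN.1.2.
have [ki|/ltnW ik] := leqP k i.
  have yE' : y = e j ^+ (i - k) by rewrite expgnFr // -yE mulgK.
  by rewrite yE'; apply: eN; rewrite -yE'.
have yE' : y^-1 = e j ^+ (k - i).
  by rewrite expgnFr // -yE invgM mulgA mulgV mul1g.
rewrite -(invgK y); apply: subgroupV nN.1 _; rewrite yE'; apply: eN.
by rewrite -yE' (hom_inv fM); apply: subgroupV sC _.
Qed.

Lemma conj_line i j v : j != 0%R -> line j v -> line j (gen i * v * (gen i)^-1).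
Proof.
move=> j0 vj; pose y : G := (\row_k (aff_char (gen i) k * v 0 k))%R.
have y0 : y 0%R 0%R = 0%R by rewrite mxE (vj 0%R) ?mulr0 // eq_sym.
have E : gen i * v = y * gen i.
  apply/rowP => k; rewrite !aff_mulE (aff_char_trans _ y0) mul1r addrC.
  by congr (_ + _)%R; rewrite mxE.
by move=> k kj; rewrite E mulgK mxE (vj k kj) mulr0.
Qed.

(** For [i < j], the conjugate of [gen j] by [gen i] is a [p]-adic power of
    [gen j]; the corresponding relator involves such a power of [e j]. *)
Lemma relator_exists : exists rel : 'I_#|pairs m| -> F, forall d,
  exists2 w, procyclic (pair_snd d) w &
    rel d = e (pair_fst d) * e (pair_snd d) * (e (pair_fst d))^-1 * w^-1 /\
    f (rel d) = 1.
Proof.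
suff /choice[rel relP] : forall d : 'I_#|pairs m|, exists x, exists2 w,
    procyclic (pair_snd d) w &
    x = e (pair_fst d) * e (pair_snd d) * (e (pair_fst d))^-1 * w^-1 /\ f x = 1.
  by exists rel.
move=> d; have lt_d : ((pair_fst d) < (pair_snd d))%N := enum_valP d.
have j0 : pair_snd d != 0%R by rewrite -val_eqE /= -lt0n; apply: leq_ltn_trans lt_d.
have [w pw fw] := line_procyclic (conj_line (pair_fst d) j0 (@gen_line _)).
exists (e (pair_fst d) * e (pair_snd d) * (e (pair_fst d))^-1 * w^-1), w => //.
by split=> //; rewrite !fM !(hom_inv fM) fw !fe mulgV.
Qed.

Variable rel : 'I_#|pairs m| -> F.
Hypothesis relP : forall d, exists2 w, procyclic (pair_snd d) w &
    rel d = e (pair_fst d) * e (pair_snd d) * (e (pair_fst d))^-1 * w^-1 /\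
    f (rel d) = 1.

Notation N := (closed_normal_closure (range rel)).

Let nN : normal_subgroup N. Proof. exact: closed_normal_closure_normal. Qed.
Let cN : closed N. Proof. exact: closed_closure. Qed.

Lemma relators_kernel : N `<=` [set x | f x = 1].
Proof.
apply: closed_normal_closure_sub.
- split; first split=> [|x y /= fx fy]; rewrite /= ?(hom_one fM) //.
    by rewrite fM (hom_inv fM) fx fy invg1 mulg1.
  by move=> x g /= fx; rewrite (hom_conj fM) fx conj1g.
- move=> x cx; apply: (row_hausdorff p_pr) => U V nU nV.
  have nfU : nbhs x (f @^-1` U) by apply: fc.
  have [y [/= fy Uy]] := cx _ nfU.
  by exists (1 : G); split; [rewrite -fy | apply: nbhs_singleton].
by move=> _ [d _ <-] /=; have [w _ []] := relP d.
Qed.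

(** The elements [a] with this property form a closed subgroup, which contains
    [e j] by the relator for the pair [(i, j)]. *)
Lemma conj_procyclic i j a : (i < j)%N -> procyclic j a ->
  mulset (procyclic j) N (e i * a * (e i)^-1).
Proof.
move=> ij; pose Q := [set a | mulset (procyclic j) N (a ^ (e i)^-1)].
suff : procyclic j `<=` Q by move=> pQ /pQ; rewrite /Q /= conjgE invgK mulgA.
have sj := procyclic_subgroup j.
apply: closed_gen_sub.
- split=> [|x y [a' [b [pa Nb xE]]] [a'' [b' [pa' Nb' yE]]]].
    by exists 1, 1; rewrite conj1g mulg1; split=> //; [apply: sj.1 | apply: nN.1.1].
  exists (a' * a''^-1), ((b * b'^-1) ^ a''^-1); split; first exact: sj.2.
    by apply: nN.2; apply: nN.1.2.
  by rewrite conjMg conjVg xE yE invgM conjgE invgK !mulgA mulgVK.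
- apply: (@preimage_closed _ _ (fun a => a ^ (e i)^-1)) => [y _|].
    exact: conjg_continuous.
  by apply: mulset_closed => //; apply: procyclic_closed.
move=> _ ->; rewrite /Q /= conjgE invgK mulgA.
have ijP : (i, j) \in pairs m by [].
have [d dE] : exists d : 'I_#|pairs m|, enum_val d = (i, j).
  by exists (enum_rank_in ijP (i, j)); rewrite enum_rankK_in.
have [w pw [rE _]] := relP d; move: pw rE; rewrite /pair_fst /pair_snd dE /= => pw rE.
exists w, (rel d ^ w); split=> //.
  by apply: nN.2; apply: sub_closed_normal_closure; exists d.
by rewrite rE conjgE !mulgA mulgV mul1g mulgVK.
Qed.

(** Normal forms modulo the relators. When the indices decrease, left
    multiplication by [e i] can be carried past the factors of larger index, so
    these products exhaust [F]. *)
Fixpoint products (l : seq 'I_m.+1) : set F :=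
  if l is j :: l' then mulset (procyclic j) (products l') else N.

Lemma products_closed l : closed (products l).
Proof.
by elim: l => // j l IHl; apply: mulset_closed => //; apply: procyclic_closed.
Qed.

Lemma products1 l : products l 1.
Proof.
elim: l => [|j l IHl]; first exact: nN.1.1.
by exists 1, 1; rewrite mulg1; split=> //; apply: (procyclic_subgroup j).1.
Qed.

Lemma products_relator l x y : N x -> products l y -> products l (x * y).
Proof.
elim: l x y => [|j l IHl] x y Nx; first exact: subgroupM nN.1 Nx.
move=> [a [b [pa lb ->]]]; exists a, (x ^ a * b); split=> //.
  by apply: IHl => //; apply: nN.2.
by rewrite [LHS]mulgA (conjgC x a) -mulgA.
Qed.

Lemma products_gen l i x : pairwise (fun j k : 'I_m.+1 => (k < j)%N) l -> i \in l ->
  products l x -> products l (e i * x).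
Proof.
elim: l x => // j l IHl x; rewrite pairwise_cons inE => /andP[/allP jl pl].
have [-> _|ij /= il] := eqVneq i j.
  move=> [a [b [pa lb ->]]]; exists (e j * a), b; rewrite mulgA; split=> //.
  exact: (subgroupM (procyclic_subgroup j) (@procyclic_gen j) pa).
move=> [a [b [pa lb ->]]].
have [a' [n [pa' Nn aE]]] := conj_procyclic (jl i il) pa.
exists a', (n * (e i * b)); split=> //.
  by apply: products_relator => //; apply: IHl.
by rewrite [RHS]mulgA -aE !mulgA mulgVK.
Qed.

Lemma products_all : products (rev (enum 'I_m.+1)) = [set: F].
Proof.
apply: F_dense; [exact: products_closed | exact: products1 |].
move=> i x; apply: products_gen; last by rewrite mem_rev mem_enum.
have : sorted (fun j k : 'I_m.+1 => (k < j)%N) (rev (enum 'I_m.+1)).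
  rewrite rev_sorted.
  have := iota_ltn_sorted 0 m.+1; rewrite -val_enum_ord sorted_map.
  exact.
rewrite sorted_pairwise // => j k l /= kj jl; exact: ltn_trans kj.
Qed.

Lemma products_line l x : products l x -> forall i, i \notin l -> f x 0%R i = 0%R.
Proof.
elim: l x => [|j l IHl] x; first by move=> /relators_kernel /= -> i _; apply: aff_oneE.
move=> [a [b [pa lb ->]]] i; rewrite inE negb_or => /andP[ij il].
by rewrite fM aff_mulE (procyclic_line pa) // IHl // mulr0 addr0.
Qed.

(** The images of the other factors vanish at the index [j] of the first one, so
    a product with trivial image has a first factor with trivial image, which is
    1; the factors are stripped off one by one. *)
Lemma products_kernel l x : uniq l -> products l x -> f x = 1 -> N x.
Proof.
elim: l x => // j l IHl x /= /andP[jl ul] [a [b [pa lb xE]]] fx1.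
have fa1 : f a = 1.
  apply/rowP => i; rewrite aff_oneE.
  have [->|ij] := eqVneq i j; last exact: (procyclic_line pa).
  have : f x 0%R j = 0%R by rewrite fx1 aff_oneE.
  by rewrite xE fM aff_mulE (products_line lb jl) mulr0 addr0.
have a1 := procyclic_inj pa fa1; rewrite xE a1 mul1g in fx1 *.
exact: IHl.
Qed.

Lemma kernel_relators : [set x | f x = 1] = N.
Proof.
apply/seteqP; split; last exact: relators_kernel.
move=> x /= fx; apply: (products_kernel (l := rev (enum 'I_m.+1))) => //.
  by rewrite rev_uniq enum_uniq.
by rewrite products_all.
Qed.

End Presentation.

Section MinimalPresentation.
Variables (p : nat) (p_pr : prime p) (m : nat).
Variables (eps : 'I_m.+1 -> padic_int p) (eps0 : eps 0%R = 1%R).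
Notation G := (aff p_pr eps0).

Lemma aff_presentation : has_presentation p G m.+1 'C(m.+1, 2).
Proof.
have [F [e [freeF dense]]] := free_pro_p_exists m.+1 p_pr; have [pF liftF] := freeF.
have [f [[hf fe] _]] := liftF G (gen p_pr eps0) (aff_pro_p p_pr eps0).
have [fM fc] := hf; rewrite -card_pairs.
have [rel relP] := relator_exists pF fM fc fe.
have fS := f_surj pF fM fc fe.
exists F, e, rel, f; split=> //.
  by apply: compact_hom_open => //; [case: pF | apply: row_hausdorff].
exact: kernel_relators relP.
Qed.

Lemma aff_finitely_presented : finitely_presented p G.
Proof. by exists m.+1, 'C(m.+1, 2); apply: aff_presentation. Qed.

Lemma aff_min_rels : min_rels p G 'C(m.+1, 2).
Proof.
split; first by exists m.+1; apply: aff_presentation.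
by move=> n k /(aff_rels_ge (p_pr := p_pr)).
Qed.

End MinimalPresentation.

(** * The uncountable family *)

Section Digits.
Local Open Scope ring_scope.
Variables (p : nat) (p_pr : prime p).
Implicit Types b : nat -> bool.

Definition digit_sum b n : int := \sum_(i < n) (b i)%:R * (p ^ i.+1)%N%:Z.

Fact digit_sum_compatible b n :
  (digit_sum b n.+1 = digit_sum b n %[mod (p ^ n)%N])%Z.
Proof.
apply/congz; exists ((b n)%:R * p%:Z); rewrite /digit_sum big_ord_recr /=.
by rewrite (natz (p ^ n)) expnSr PoszM mulrCA.
Qed.

(** As these exponents are multiples of [p], none of them is 1 and no two of them
    are inverse to each other. *)
Definition parameter b : padic_int p := mk_padic (digit_sum_compatible b).

Lemma parameter_level1 b : parameter b 1%N = 0.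
Proof.
rewrite (_ : parameter b 1%N = (digit_sum b 1 %% (p ^ 1)%N)%Z) //.
by rewrite /digit_sum big_ord1 /= expn1 modzMl.
Qed.

Lemma parameter_inj : injective parameter.
Proof.
move=> b c bc; apply/funext => i; elim/ltn_ind: i => i IHi.
have : ((p ^ i.+2)%N %| digit_sum b i.+2 - digit_sum c i.+2)%Z.
  rewrite -eqz_mod_dvd; apply/eqP.
  exact: (congr1 (fun x : padic_int p => x i.+2) bc).
rewrite /digit_sum !big_ord_recr /= [X in X + _ + _](eq_bigr (fun j : 'I_i =>
  (c j)%:R * (p ^ j.+1)%N%:Z)) => [|j _]; last by rewrite IHi.
set S := \sum_(_ < _) _; set B := (p ^ i.+2)%N%:Z.
have -> : S + (b i)%:R * (p ^ i.+1)%N%:Z + (b i.+1)%:R * B -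
    (S + (c i)%:R * (p ^ i.+1)%N%:Z + (c i.+1)%:R * B) =
    ((b i)%:R - (c i)%:R) * (p ^ i.+1)%N%:Z + ((b i.+1)%:R - (c i.+1)%:R) * B by ring.
rewrite rpredDr; last exact: dvdz_mull.
move=> BP; have {BP} : (p%:Z * (p ^ i.+1)%N%:Z %|
    ((b i)%:R - (c i)%:R) * (p ^ i.+1)%N%:Z)%Z.
  by rewrite -PoszM -expnS.
rewrite dvdz_mul2r; last first.
  by rewrite -lt0n expn_gt0 prime_gt0.
case: (b i) (c i) => [] [] //=; rewrite ?subr0 ?sub0r ?dvdzE ?abszN /= dvdn1;
  by case: (p) p_pr => [|[]].
Qed.

End Digits.

Lemma uncountable_bool_seq : ~ countable [set: nat -> bool].
Proof.
case/countable_injP => f f_inj_in.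
have f_inj : injective f by move=> b c; apply: f_inj_in; rewrite inE.
(* Cantor's diagonal sequence. *)
pose d n := ~~ `[< exists2 b, f b = n & b n >].
have : d (f d) = ~~ d (f d).
  rewrite {1}/d; congr (~~ _); apply/asboolP/idP => [[b /f_inj <-]//|dd].
  by exists d.
by case: (d _).
Qed.

Theorem theorem1p1 (p m : nat) (p_prime : prime p) (m_ge3 : (3 <= m)%N) :
  (exists (I : Type) (G : I -> topGroupType),
     [/\ ~ countable [set: I],
         (forall i, [/\ uniform_pro_p p (G i), metabelian (G i)
                      & analytic_group_dim p (G i) m])
       & forall i j, i <> j -> ~ commensurable (G i) (G j)])
  /\
  (exists (I : Type) (G : I -> topGroupType),
     [/\ ~ countable [set: I],
         (forall i, [/\ pro_p p (G i), finitely_presented p (G i),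
                        min_gens (G i) m & min_rels p (G i) 'C(m, 2)])
       & forall i j, i <> j -> ~ commensurable (G i) (G j)]).
Proof.
have [k mE] : exists k, m = k.+3 by exists (m - 3)%N; rewrite -addn3 subnK.
rewrite {}mE {m m_ge3}.
pose G (b : nat -> bool) := fam p_prime k (parameter p b).
have G_commens b c : b <> c -> ~ commensurable (G b) (G c).
  move=> bc /fam_commensurable E; apply: bc; apply: (parameter_inj p_prime).
  by apply: E; apply: parameter_level1.
split; exists (nat -> bool), G; split=> //; try exact: uncountable_bool_seq.
  move=> b; split; first exact: aff_uniform.
    exact: aff_metabelian.
  exact: aff_analytic.
move=> b; split; first exact: aff_pro_p.
- exact: aff_finitely_presented.
- exact: aff_min_gens.
- exact: aff_min_rels.
Qed.
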